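(* Let $p\ge 2$ be an integer and let $\tilde Q_{\mathbb{Z}}$ be a non-deterministic Extended Ergodic CP Distribution on $\mathcal{M}^*\times\Lambda_p^{\mathbb{Z}}$. Then for $\hat\nu\tilde Q_{\mathbb{Z}}$-almost every $\nu\in\mathcal{M}^*$ there is a sequence $(k_n)_{n\in\mathbb{N}}$ in $\mathbb{Z}\setminus\{0\}$ such that $t_{k_n}^*\nu\to\nu$ in the weak topology. Here $\hat\nu\tilde Q_{\mathbb{Z}}$ is the pushforward of $\tilde Q_{\mathbb{Z}}$ by $\hat\nu(\nu,\boldsymbol{i})=\nu$.
   Context: All spaces are separable metric spaces with their Borel $\sigma$-algebras. $\mathcal{M}(\mathbb{R})$ is the space of positive Radon measures on $\mathbb{R}$ (including $0$) with the weak topology ($\nu_n\to\nu$ iff $\int f\,d\nu_n\to\int f\,d\nu$ for all $f\in C_c(\mathbb{R})$). For a measurable map $\rho$, $\rho\nu$ denotes the pushforward of $\nu$ by $\rho$. $\mathbb{N}=\{1,2,\ldots\}$. Normalization: for $0\ne\nu\in\mathcal{M}(\mathbb{R})$ put $\psi(\nu)=\min\{n\in\mathbb{N}:\nu[-(n-1),n)>0\}$ and $N\nu=\nu/\nu[-(\psi(\nu)-1),\psi(\nu))$; put $N0=0$. $\mathcal{M}^*=N(\mathcal{M}(\mathbb{R}))$ is the space of normalized measures. Fix an integer $p\ge2$, $\Lambda_p=\{0,\ldots,p-1\}$. For $j\in\Lambda_p$: $[j)_p=[\frac jp,\frac{j+1}p)$ and $\rho_j(x)=px-j$. On $\mathcal{M}^*\times\Lambda_p^{\mathbb{Z}}$,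 with points $(\nu,\boldsymbol{i})$, $\boldsymbol{i}=(i_n)_{n\in\mathbb{Z}}$, let $\hat\nu(\nu,\boldsymbol{i})=\nu$, $\hat i_n(\nu,\boldsymbol{i})=i_n$, and $M_p(\nu,\boldsymbol{i})=(N\rho_{i_1}\nu,\boldsymbol{\sigma}(\boldsymbol{i}))$, where $(\boldsymbol{\sigma}(\boldsymbol{i}))_n=i_{n+1}$. A Borel probability measure $\tilde Q_{\mathbb{Z}}$ on $\mathcal{M}^*\times\Lambda_p^{\mathbb{Z}}$ is adapted if for every $j\in\Lambda_p$ and almost every $(\nu,\boldsymbol{i})$, $\mathbb{P}_{\tilde Q_{\mathbb{Z}}}(\hat i_1=j\mid\hat\nu,(\hat i_n)_{n\le0})(\nu,\boldsymbol{i})=\nu[j)_p$. It is an Extended Ergodic CP Distribution (Extended ECPD) if it is adapted and is invariant and ergodic under $M_p$. It is deterministic if for almost every $(\nu,\boldsymbol{i})$, $\mathbb{P}_{\tilde Q_{\mathbb{Z}}}(\hat i_1=i_1\mid\hat\nu,(\hat i_n)_{n\le0})(\nu,\boldsymbol{i})=1$, and non-deterministic otherwise. Translations: $t_x(y)=y-x$ on $\mathbb{R}$, $t_x\nu$ is the pushforward, $t_x^*\nu=Nt_x\nu$. *)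

(* Defs.v *)
From HB Require Import structures.
From mathcomp Require Import all_boot all_order all_algebra.
From mathcomp Require Import all_classical all_reals all_analysis.
From mathcomp Require Import measurable_realfun lra.

Set Implicit Arguments.
Unset Strict Implicit.
Unset Printing Implicit Defensive.

Import Order.TTheory GRing.Theory Num.Theory.
Import numFieldNormedType.Exports.

Local Open Scope classical_set_scope.
Local Open Scope ring_scope.

(* A [{measure set T -> \bar R}] of the library is a function on all subsets
   of T whose values on non-measurable sets are unconstrained.  Requiring these
   values to be 0 makes equality of Radon measures the usual one: see
   [radon_ext].  On R, a Borel measure is Radon iff it is finite on compact
   sets. *)
Record radon (R : realType) := Radon {
  radon_measure :> {measure set (measurableTypeR R) -> \bar R};
  radon_compact : forall K : set R, compact K -> (radon_measure K < +oo)%E;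
  radon_nonmeasurable : forall A : set (measurableTypeR R),
    ~ measurable A -> radon_measure A = 0%E }.

Lemma radon_ext (R : realType) (mu nu : radon R) :
  (forall A : set (measurableTypeR R), measurable A -> mu A = nu A) -> mu = nu.
Proof.
case: mu => mu muK mu0; case: nu => nu nuK nu0 /= munu.
have eqf : mu = nu :> (set _ -> \bar R).
  apply/funext => A; have [mA|nA] := pselect (measurable A); first exact: munu.
  by rewrite mu0// nu0.
have eqm : mu = nu.
  move: eqf; clear; move: mu nu => [f [[f1 f2] [f3]]] [g [[g1 g2] [g3]]] /= fg.
  subst g; have -> : f1 = g1 by exact: Prop_irrelevance.
  have e2 : f2 = g2 by exact: Prop_irrelevance.
  move: f3 g3; rewrite e2 => f3 g3.
  by have -> : f3 = g3 by exact: Prop_irrelevance.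
subst nu; congr Radon; exact: Prop_irrelevance.
Qed.

HB.instance Definition _ (R : realType) := gen_eqMixin (radon R).
HB.instance Definition _ (R : realType) := gen_choiceMixin (radon R).

Lemma radon_zero_compact (R : realType) (K : set R) : compact K ->
  ((mzero : {measure set (measurableTypeR R) -> \bar R}) K < +oo)%E.
Proof. by rewrite /mzero ltry. Qed.

Lemma radon_zero_nonmeasurable (R : realType) (A : set (measurableTypeR R)) :
  ~ measurable A ->
  (mzero : {measure set (measurableTypeR R) -> \bar R}) A = 0%E.
Proof. by []. Qed.

Definition radon_zero (R : realType) : radon R :=
  Radon (@radon_zero_compact R) (@radon_zero_nonmeasurable R).

HB.instance Definition _ (R : realType) :=
  isPointed.Build (radon R) (radon_zero R).

Definition Cc (R : realType) : Type :=
  {f : R -> R | continuous f /\ compact (closure [set x | f x != 0])}.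

Definition radon_integral (R : realType) (nu : radon R) :
  {ptws Cc R -> R} := fun f => \int[radon_measure nu]_x (sval f x).

(* The weak topology: the coarsest one for which [nu |-> \int f dnu] is
   continuous for every f in C_c(R). *)
HB.instance Definition _ (R : realType) :=
  Topological.copy (radon R) (initial_topology (@radon_integral R)).

Section pushforward_homeo.
Variables (R : realType) (f g : R -> R).
Hypotheses (cf : continuous f) (cg : continuous g).
Hypotheses (fK : cancel f g) (gK : cancel g f).
Variable nu : radon R.

Let mf : measurable_fun [set: measurableTypeR R] (f : _ -> measurableTypeR R).
Proof. exact: continuous_measurable_fun. Qed.

Let mg : measurable_fun [set: measurableTypeR R] (g : _ -> measurableTypeR R).
Proof. exact: continuous_measurable_fun. Qed.

Let push : {measure set (measurableTypeR R) -> \bar R} :=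
  measure_function_pushforward__canonical__measure_function_Measure nu mf.

Let push_compact (K : set R) : compact K -> (push K < +oo)%E.
Proof.
move=> cK; rewrite /push /= /pushforward.
have -> : f @^-1` K = g @` K.
  apply/seteqP; split => [x Kx|_ [y Ky <-]]; first by exists (f x).
  by rewrite /preimage /= gK.
apply: radon_compact; apply: continuous_compact => //.
exact: continuous_subspaceT.
Qed.

Let push_nonmeasurable (A : set (measurableTypeR R)) :
  ~ measurable A -> push A = 0%E.
Proof.
move=> nA; rewrite /push /= /pushforward; apply: radon_nonmeasurable => mfA.
apply: nA; have := mg measurableT mfA; rewrite setTI.
by rewrite -comp_preimage (_ : f \o g = id)//; apply/funext => x /=.
Qed.

(* The pushforward of nu by the homeomorphism f; g is the inverse of f. *)
Definition radon_pushforward : radon R := Radon push_compact push_nonmeasurable.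

Lemma radon_pushforwardE (A : set R) : radon_pushforward A = nu (f @^-1` A).
Proof. by []. Qed.

End pushforward_homeo.

Section affine_pushforwards.
Variable R : realType.

Lemma translation_continuous (x : R) : continuous (fun y : R => y - x).
Proof. by move=> y; apply: cvgB; [exact: cvg_id|exact: cvg_cst]. Qed.

Lemma translationK (x : R) : cancel (fun y : R => y - x) (fun y => y - - x).
Proof. by move=> y /=; rewrite opprK subrK. Qed.

Lemma translationVK (x : R) : cancel (fun y => y - - x) (fun y : R => y - x).
Proof. by move=> y /=; rewrite opprK addrK. Qed.

Definition translate (x : R) (nu : radon R) : radon R :=
  radon_pushforward (@translation_continuous x) (@translation_continuous (- x))
    (@translationK x) (@translationVK x) nu.

Definition rho (p : nat) (j : 'I_p) (x : R) : R := p%:R * x - (j : nat)%:R.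

Definition rho_inv (p : nat) (j : 'I_p) (y : R) : R :=
  (y + (j : nat)%:R) / p%:R.

Lemma ord_natr_neq0 (p : nat) (j : 'I_p) : p%:R != 0 :> R.
Proof. by rewrite pnatr_eq0 -lt0n (leq_ltn_trans _ (ltn_ord j)). Qed.

Lemma rho_continuous (p : nat) (j : 'I_p) : continuous (rho j).
Proof.
by move=> x; apply: cvgB; [apply: cvgMr; exact: cvg_id|exact: cvg_cst].
Qed.

Lemma rho_inv_continuous (p : nat) (j : 'I_p) : continuous (rho_inv j).
Proof.
by move=> x; apply: cvgMl; apply: cvgD; [exact: cvg_id|exact: cvg_cst].
Qed.

Lemma rhoK (p : nat) (j : 'I_p) : cancel (rho j) (rho_inv j).
Proof.
by move=> x; rewrite /rho /rho_inv subrK mulrC mulKf// (ord_natr_neq0 j).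
Qed.

Lemma rho_invK (p : nat) (j : 'I_p) : cancel (rho_inv j) (rho j).
Proof.
by move=> x; rewrite /rho /rho_inv mulrC divfK ?addrK// (ord_natr_neq0 j).
Qed.

Definition rho_pushforward (p : nat) (j : 'I_p) (nu : radon R) : radon R :=
  radon_pushforward (@rho_continuous p j) (@rho_inv_continuous p j)
    (@rhoK p j) (@rho_invK p j) nu.

End affine_pushforwards.

Section scale.
Variables (R : realType) (c : {nonneg R}) (nu : radon R).

Let scaled : {measure set (measurableTypeR R) -> \bar R} := mscale c nu.

Let scaled_compact (K : set R) : compact K -> (scaled K < +oo)%E.
Proof. by move=> cK; apply: lte_mul_pinfty => //; exact: radon_compact. Qed.

Let scaled_nonmeasurable (A : set (measurableTypeR R)) :
  ~ measurable A -> scaled A = 0%E.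
Proof. by move=> nA; rewrite /scaled /= /mscale radon_nonmeasurable ?mule0. Qed.

Definition radon_scale : radon R := Radon scaled_compact scaled_nonmeasurable.

End scale.

Section normalization.
Variable R : realType.
Implicit Type nu : radon R.

Definition core (n : nat) : set R := `[- (n%:R - 1), n%:R[.

Definition charges_core nu (n : nat) : bool :=
  (0 < n)%N && (0 < nu (core n))%E.

Lemma charges_core_ex nu : nu <> radon_zero R -> exists n, charges_core nu n.
Proof.
apply: contra_notP => /forallNP noc; apply: radon_ext => A mA.
have coreT : \bigcup_n core n.+1 = [set: R].
  rewrite -subTset => x _; exists (Num.truncn `|x|).+1 => //=.
  have xn : `|x| < (Num.truncn `|x|).+1%:R := truncnS_gt _.
  by rewrite /core /= in_itv/= -natr1; move: xn; rewrite ltr_norml; lra.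
have core0 n : nu (core n.+1) = 0%E.
  apply/eqP; rewrite -measure_le0 leNgt; apply/negP => c0.
  by apply: (noc n.+1); rewrite /charges_core c0.
apply: (measure_negligible (mu := radon_measure nu)) => //.
have : [set: R] `<=` \bigcup_n core n.+1 by rewrite coreT.
move=> /(subset_trans (@subsetT _ A)) /negligibleS; apply.
apply: negligible_bigcup => n; apply/negligibleP; last exact: core0.
exact: measurable_itv.
Qed.

(* By charges_core_ex, the default value 1 is only taken at nu = 0. *)
Definition psi nu : nat :=
  match pselect (exists n, charges_core nu n) with
  | left ex => ex_minn ex
  | right _ => 1
  end.

Lemma core_weight_ge0 nu : 0 <= (fine (nu (core (psi nu))))^-1.
Proof. by rewrite invr_ge0 fine_ge0. Qed.

(* As 0^-1 = 0, the zero measure is mapped to itself. *)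
Definition normalize nu : radon R := radon_scale (NngNum (core_weight_ge0 nu)) nu.

Lemma normalize_zero : normalize (radon_zero R) = radon_zero R.
Proof. by apply: radon_ext => A _; rewrite /= /mscale /= /mzero mule0. Qed.

End normalization.

(* The space M^* of normalized measures, with the subspace topology. *)
Definition normalized (R : realType) : Type := set_type (range (@normalize R)).

HB.instance Definition _ (R : realType) :=
  Topological.copy (normalized R) (set_type (range (@normalize R))).

Definition normalize_in (R : realType) (nu : radon R) : normalized R :=
  exist _ (normalize nu) (mem_set (imageT (@normalize R) nu)).

Lemma initial_cvgP (S : choiceType) (T : topologicalType) (f : S -> T)
  (F : set_system S) (s : S) : Filter F ->
  F --> (s : initial_topology f) <-> f @ F --> f s.
Proof.
move=> FF; split=> [Fs|Fs A].
  by apply: cvg_comp; [exact: Fs|exact: initial_continuous].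
move=> [_ [[B oB <-] Bs sBA]]; apply: (filterS sBA).
by apply: Fs; exact: open_nbhs_nbhs.
Qed.

Lemma normalized_cvgP (R : realType) (F : set_system (normalized R))
    (nu : normalized R) : Filter F ->
  F --> nu <->
  forall f : R -> R, continuous f ->
    compact (closure [set x | f x != 0]) ->
    \int[radon_measure (set_val mu)]_x f x @[mu --> F] -->
      \int[radon_measure (set_val nu)]_x f x.
Proof.
move=> FF; split.
  move=> /(@initial_cvgP (set_type (range (@normalize R))) (radon R) set_val).
  move=> /(@initial_cvgP _ _ (@radon_integral R)) /cvg_sup h f cf Kf.
  exact: (iffLR (@initial_cvgP _ R _ _ _ _) (h (exist _ f (conj cf Kf)))).
move=> h.
apply/(@initial_cvgP (set_type (range (@normalize R))) (radon R) set_val).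
apply/(@initial_cvgP _ _ (@radon_integral R)).
apply/cvg_sup => -[f [cf Kf]].
apply/(@initial_cvgP {ptws Cc R -> R} R
  (fun g : {ptws Cc R -> R} => g (exist _ f (conj cf Kf)))); exact: h.
Qed.

HB.instance Definition _ (R : realType) :=
  isPointed.Build (normalized R) (normalize_in (radon_zero R)).

Definition translate_star (R : realType) (x : R) (nu : normalized R) :
  normalized R := normalize_in (translate x (set_val nu)).

(* The type of digits 0, ..., p - 1; it depends on a proof of 2 <= p because the
   library only has measurable structures on pointed types. *)
Definition digit (p : nat) (p_ge2 : (2 <= p)%N) : Type :=
  discrete_topology 'I_p.

HB.instance Definition _ (p : nat) (p_ge2 : (2 <= p)%N) :=
  Topological.copy (digit p_ge2) (discrete_topology 'I_p).
HB.instance Definition _ (p : nat) (p_ge2 : (2 <= p)%N) :=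
  isPointed.Build (digit p_ge2) (Ordinal (ltnW p_ge2)).

Definition borel (T : ptopologicalType) := g_sigma_algebraType (@open T).

Definition digit_seq (p : nat) (p_ge2 : (2 <= p)%N) : Type :=
  {ptws int -> digit p_ge2}.

HB.instance Definition _ (p : nat) (p_ge2 : (2 <= p)%N) :=
  Topological.copy (digit_seq p_ge2) {ptws int -> digit p_ge2}.
HB.instance Definition _ (p : nat) (p_ge2 : (2 <= p)%N) :=
  isPointed.Build (digit_seq p_ge2) (fun=> point).

Definition cp_space (R : realType) (p : nat) (p_ge2 : (2 <= p)%N) : Type :=
  normalized R * digit_seq p_ge2.

HB.instance Definition _ (R : realType) (p : nat) (p_ge2 : (2 <= p)%N) :=
  Topological.copy (cp_space R p_ge2) (normalized R * digit_seq p_ge2)%type.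
HB.instance Definition _ (R : realType) (p : nat) (p_ge2 : (2 <= p)%N) :=
  Pointed.copy (cp_space R p_ge2) (normalized R * digit_seq p_ge2)%type.

Section cp_distributions.
Variables (R : realType) (p : nat) (p_ge2 : (2 <= p)%N).

Local Notation D := (digit p_ge2).
Local Notation X := (borel (cp_space R p_ge2)).
Local Notation M := (borel (normalized R)).

Definition nu_hat (x : X) : M := x.1.

Definition i_hat (n : int) (x : X) : D := x.2 n.

Definition M_map (x : X) : X :=
  (normalize_in (rho_pushforward (x.2 1) (set_val x.1)), fun n => x.2 (n + 1)).

Definition past : set (set X) :=
  <<s [set nu_hat @^-1` A | A in measurable] `|`
      [set i_hat n @^-1` B | n in [set n | n <= 0] & B in [set: set D]] >>.

Definition cell (j : D) : set R :=
  `[(j : nat)%:R / p%:R, (j : nat).+1%:R / p%:R[.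

Variable Q : probability X R.

(* f is a version of the conditional probability of E given G; such a version
   exists for every sub-sigma-algebra G and is unique up to a Q-null set, so
   that below "some version" and "every version" are interchangeable. *)
Definition is_cond_prob (G : set (set X)) (E : set X) (f : X -> R) : Prop :=
  [/\ forall B : set R, measurable B -> G (f @^-1` B),
      Q.-integrable [set: X] (EFin \o f) &
      forall A, G A -> (\int[Q]_(x in A) (f x)%:E = Q (A `&` E))%E].

Definition adapted : Prop := forall j : D,
  exists2 f, is_cond_prob past [set x | i_hat 1 x = j] f &
    \forall x \ae Q, (f x)%:E = set_val (nu_hat x) (cell j).

Definition invariant : Prop :=
  forall A : set X, measurable A -> Q (M_map @^-1` A) = Q A.

Definition ergodic : Prop :=
  forall A : set X, measurable A -> M_map @^-1` A = A ->
    Q A = 0%E \/ Q A = 1%E.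

Definition extended_ECPD : Prop := [/\ adapted, invariant & ergodic].

Definition deterministic : Prop :=
  exists2 f : D -> X -> R,
    forall j, is_cond_prob past [set x | i_hat 1 x = j] (f j) &
    \forall x \ae Q, f (i_hat 1 x) x = 1.

End cp_distributions.

(* Main.v *)
Require Import Defs.
From mathcomp Require Import all_boot all_order all_algebra.
From mathcomp Require Import all_classical all_reals all_analysis.
From mathcomp Require Import measurable_realfun ring lra.

Import Order.TTheory GRing.Theory Num.Theory.
Import numFieldNormedType.Exports.

Set Implicit Arguments.
Unset Strict Implicit.
Unset Printing Implicit Defensive.

Local Open Scope classical_set_scope.
Local Open Scope ring_scope.

(** A state [nu] determines the conditional probabilities of its next digits, and
    reading [n] digits replaces [nu] by its normalized blow-up around one of the
    [p ^ n] cells of level [n] of the unit interval. Two such blow-ups of the same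
    state are integer translates of each other, up to normalization
    ([translate_star_act]).

    Fix a set [B] of normalized measures, and consider the measures of [B] that no
    translation by a nonzero integer brings back to [B] ([isolated]). Among the
    blow-ups of level [n] of a given state at most one is isolated in [B]. By
    invariance, the probability that the present state is isolated in [B] equals
    the probability that the state at time [n] is; for this to happen, the next
    [n] digits must form one particular word that is a function of the initial
    state, and given the past this has probability the mass of a single cell of
    level [n] ([measure_digits]). In the non-deterministic case the mass of the
    cell that is read at time [n] tends to 0: by ergodicity almost every orbit
    meets infinitely often a set on which the next step multiplies this mass by a
    factor bounded away from 1 ([cvg_heavy]). So the measures that are isolated in
    [B] form a null set ([unique_word_null], [isolated_nu_hat_null]). Letting [B]
    run through a countable base of the weak topology, almost every [nu] has
    translates by nonzero integers in each of its neighbourhoods.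

    Two points need care. First, the conditional probability of a word is a product
    of conditional probabilities taken at successive times, given successive
    pasts; to see the past at time 0 in the past at time 1, the state at time 0 must
    be recovered from its blow-up. This is possible because measures live on the
    whole line: the map on states and digit sequences has an exact left inverse that
    respects the past ([M_mapK], [past_M_inverse]). Second, all maps involved have
    to be Borel and the weak topology needs a countable base. Both follow from the
    fact that the integrals of countably many piecewise linear functions detect
    weak convergence ([cvg_plateau_cc], [measurable_fun_borel]). *)

(** * Conditional densities *)

Lemma measurable_preT d d' (X : measurableType d) (Y : measurableType d')
    (f : X -> Y) (B : set Y) :
  measurable_fun setT f -> measurable B -> measurable (f @^-1` B).
Proof. by move=> mf mB; rewrite -[X in measurable X]setTI; exact: mf. Qed.

Lemma measurable_fun_fincase d d' (X : measurableType d) (Y : measurableType d')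
    (D : finType) (a : X -> D) (h : D -> X -> Y) :
  (forall j, measurable [set x | a x = j]) ->
  (forall j, measurable_fun setT (h j)) ->
  measurable_fun setT (fun x => h (a x) x).
Proof.
move=> ma mh _ B mB; rewrite setTI.
have -> : (fun x => h (a x) x) @^-1` B =
    \bigcup_(j in [set: D]) ([set x | a x = j] `&` h j @^-1` B).
  by apply/seteqP; split => [x Bx|x [j _ [/= <-]]//]; exists (a x).
apply: fin_bigcup_measurable => [|j _]; first exact: finite_finset.
by apply: measurableI => //; exact: measurable_preT.
Qed.

Section conditional_density.
Local Open Scope ereal_scope.
Context d dM (X : measurableType d) (M : measurableType dM) (R : realType).
Variables (Q : probability X R) (nu : X -> M) (phi : X -> R) (A E : set X).
Hypotheses (mnu : measurable_fun setT nu) (mphi : measurable_fun setT phi).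
Hypotheses (phi_ge0 : forall x, (0 <= phi x)%R).
Hypotheses (mA : measurable A) (mE : measurable E).
Hypothesis density : forall B, measurable B ->
  Q (A `&` nu @^-1` B `&` E) = \int[Q]_(x in A `&` nu @^-1` B) (phi x)%:E.

Import HBNNSimple.

Let density_nnsfun (h : {nnsfun M >-> R}) :
  \int[Q]_(x in A `&` E) (h (nu x))%:E =
  \int[Q]_(x in A) ((phi x)%:E * (h (nu x))%:E).
Proof.
have mAE : measurable (A `&` E) by exact: measurableI.
have mi r : measurable_fun setT (fun x => (\1_(h @^-1` [set r]) (nu x) : R)).
  by apply: (measurableT_comp _ mnu).
have mir r : measurable_fun setT
    (fun x => r * \1_(h @^-1` [set r]) (nu x) : R)%R.
  exact: measurable_funM.
under [LHS]eq_integral do rewrite fimfunE -fsumEFin//.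
rewrite ge0_integral_fsum//; last 2 first.
- by move=> r; apply/measurable_EFinP/measurable_funTS; exact: mir.
- by move=> r x _; rewrite EFinM nnfun_muleindic_ge0.
under [RHS]eq_integral.
  move=> x _; rewrite fimfunE -fsumEFin// ge0_mule_fsumr; last first.
    by move=> r; rewrite EFinM nnfun_muleindic_ge0.
  over.
rewrite ge0_integral_fsum//; last 2 first.
- move=> r; apply: emeasurable_funM;
    exact/measurable_EFinP/measurable_funTS.
- move=> r x _; apply: mule_ge0; first by rewrite lee_fin.
  by rewrite EFinM nnfun_muleindic_ge0.
apply: eq_fsbigr => r _.
have [r0|r0] := ltP r 0%R.
  by rewrite preimage_nnfun0// !integral0_eq// => x _;
    rewrite indic0 mulr0 ?mule0.
have mh : measurable (nu @^-1` (h @^-1` [set r])).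
  by rewrite -[X in measurable X]setTI; apply: mnu.
have E1 (x : X) : \1_(h @^-1` [set r]) (nu x) =
    \1_(nu @^-1` (h @^-1` [set r])) x :> R.
  by rewrite !indicE.
under eq_integral do rewrite EFinM E1.
rewrite ge0_integralZl//; last exact/measurable_EFinP/measurable_funTS.
rewrite integral_indic//.
rewrite [X in _ * X](_ : _ =
    \int[Q]_(x in A `&` nu @^-1` (h @^-1` [set r])) (phi x)%:E); last first.
  by rewrite -density// setIC -setIAC.
under [RHS]eq_integral do rewrite EFinM muleCA.
rewrite ge0_integralZl//; last 2 first.
- by apply: emeasurable_funM; apply/measurable_EFinP/measurable_funTS.
- by move=> x _; rewrite mule_ge0// lee_fin.
congr (_ * _); rewrite integral_mkcondr; apply: eq_integral => x _.
by rewrite epatch_indic/= E1.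
Qed.

(** Passing from sets to integrands: approximate the integrand by simple
    functions of [nu] and use monotone convergence on both sides. *)
Lemma integral_conditional_density (h : M -> R) :
  measurable_fun setT h -> (forall m, (0 <= h m)%R) ->
  \int[Q]_(x in A `&` E) (h (nu x))%:E =
  \int[Q]_(x in A) (phi x * h (nu x))%:E.
Proof.
move=> mh h0; have mAE : measurable (A `&` E) by exact: measurableI.
have meh : measurable_fun setT (EFin \o h) by exact/measurable_EFinP.
pose f_ := nnsfun_approx measurableT meh.
have mf n : measurable_fun setT (fun x => (f_ n (nu x))%:E).
  by apply/measurable_EFinP; apply: measurableT_comp.
have cf (m : M) : (f_ n m)%:E @[n --> \oo] --> (h m)%:E.
  by apply: (cvg_nnsfun_approx measurableT meh) => // m' _; rewrite lee_fin.
have nd a b x : (a <= b)%N -> (f_ a x <= f_ b x)%R.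
  by move=> ab; exact/lefP/nd_nnsfun_approx.
transitivity (limn (fun n => \int[Q]_(x in A `&` E) (f_ n (nu x))%:E)).
  rewrite -monotone_convergence//=.
  - by apply: eq_integral => x _; apply/esym/cvg_lim => //; exact: cf.
  - by move=> n; exact: measurable_funTS.
  - by move=> n x _; rewrite lee_fin.
  - by move=> x _ a b ab; rewrite lee_fin; exact: nd.
transitivity (limn (fun n => \int[Q]_(x in A) ((phi x)%:E * (f_ n (nu x))%:E))).
  by congr (limn _); apply/funext => n; exact: density_nnsfun.
rewrite -monotone_convergence//=.
- apply: eq_integral => x _; apply/cvg_lim => //; rewrite EFinM.
  by apply: cvgeZl => //; exact: cf.
- move=> n; apply: emeasurable_funM; last exact: measurable_funTS.
  exact/measurable_EFinP/measurable_funTS.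
- by move=> n x _; rewrite mule_ge0// lee_fin.
- by move=> x _ a b ab; rewrite lee_wpmul2l// lee_fin//; exact: nd.
Qed.

End conditional_density.

(** * Digit processes *)

Section digit_process.

(** [T] moves to the next time, [S] goes back. A point has a state [nu] and reads
    the digit [a]; [b] is the digit read last. The state determines the conditional
    probabilities [g] of the next digit given the past [F], and together with that
    digit it determines the next state, by [Phi]. *)
Context d dM (X : measurableType d) (M : measurableType dM) (R : realType).
Variables (D : finType) (Q : probability X R) (T S : X -> X) (nu : X -> M).
Variables (a b : X -> D) (Phi : D -> M -> M) (g : D -> M -> R).
Variable F : set (set X).

Fixpoint act (w : seq D) (m : M) : M :=
  if w is j :: w' then act w' (Phi j m) else m.

(** By [measure_digits], the conditional probability, given the past, that the
    next digits of a point in state [m] are [w]. *)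
Fixpoint weight (w : seq D) (m : M) : R :=
  if w is j :: w' then g j m * weight w' (Phi j m) else 1.

Fixpoint digits (n : nat) (x : X) : seq D :=
  if n is n'.+1 then a x :: digits n' (T x) else [::].

Definition gain (x : X) : R := g (a x) (nu x).

Hypothesis mT : measurable_fun setT T.
Hypothesis mnu : measurable_fun setT nu.
Hypothesis ma : forall j, measurable [set x | a x = j].
Hypothesis mPhi : forall j, measurable_fun setT (Phi j).
Hypothesis mg : forall j, measurable_fun setT (g j).
Hypothesis g_ge0 : forall j m, 0 <= g j m.
Hypothesis g_le1 : forall j m, g j m <= 1.
Hypothesis T_inv : forall A, measurable A -> Q (T @^-1` A) = Q A.
Hypothesis T_erg : forall A, measurable A -> T @^-1` A = A ->
  Q A = 0%E \/ Q A = 1%E.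
Hypothesis TK : cancel T S.
Hypothesis bT : forall x, b (T x) = a x.
Hypothesis nuT : forall x, nu (T x) = Phi (a x) (nu x).
Hypothesis F_meas : F `<=` measurable.
Hypothesis F_setI : forall A B, F A -> F B -> F (A `&` B).
Hypothesis F_nu : forall B, measurable B -> F (nu @^-1` B).
Hypothesis F_b : forall j, F [set x | b x = j].
Hypothesis F_S : forall A, F A -> F (S @^-1` A).
Hypothesis g_cond : forall j A, F A ->
  Q (A `&` [set x | a x = j]) = (\int[Q]_(x in A) (g j (nu x))%:E)%E.

Lemma size_digits n x : size (digits n x) = n.
Proof. by elim: n x => //= n IH x; rewrite IH. Qed.

Lemma nu_iter n x : nu (iter n T x) = act (digits n x) (nu x).
Proof. by elim: n x => // n IH x; rewrite iterSr IH /= nuT. Qed.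

Lemma weight_ge0 w m : 0 <= weight w m.
Proof. by elim: w m => //= j w IH m; rewrite mulr_ge0. Qed.

Lemma measurable_act w : measurable_fun setT (act w).
Proof. by elim: w => //= j w IH; exact: measurableT_comp IH (mPhi j). Qed.

Lemma measurable_weight w : measurable_fun setT (weight w).
Proof.
elim: w => [|j w IH] /=; first exact: measurable_cst.
by apply: measurable_funM => //; exact: measurableT_comp IH (mPhi j).
Qed.

Lemma measurable_iter n : measurable_fun setT (iter n T).
Proof. elim: n => [|n IH]; first exact: measurable_id.
exact: (measurableT_comp mT IH). Qed.

Lemma measurable_digits n w : measurable [set x | digits n x = w].
Proof.
elim: n w => [|n IH] [|j w] /=.
- rewrite (_ : [set _ | _] = setT)//; exact/seteqP.
- by rewrite (_ : [set _ | _] = set0)//; apply/seteqP; split.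
- by rewrite (_ : [set _ | _] = set0)//; apply/seteqP; split.
- rewrite (_ : [set _ | _] = [set x | a x = j] `&`
      T @^-1` [set x | digits n x = w]).
    by apply: measurableI => //; exact: measurable_preT.
  by apply/seteqP; split => x /= [-> ->].
Qed.

(** By induction on the word, prepending one digit: since [S] is a left
    inverse of [T] that respects the past, the event that the first digit is
    [j], intersected with a past event, is the preimage by [T] of a past
    event, to which invariance and the induction hypothesis apply. *)
Lemma measure_digits A w : F A ->
  Q (A `&` [set x | digits (size w) x = w]) =
  (\int[Q]_(x in A) (weight w (nu x))%:E)%E.
Proof.
elim: w A => [|j w IH] A FA /=.
  rewrite (_ : [set _ | _] = setT); last exact/seteqP.
  rewrite setIT (eq_integral (cst 1%E))// integral_cst ?mul1e//; exact: F_meas.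
pose A' := S @^-1` A `&` [set x | b x = j].
have FA' : F A' by apply: F_setI; [exact: F_S|exact: F_b].
have TA' : A `&` [set x | a x = j] = T @^-1` A'.
  by apply/seteqP; split => x /=; rewrite /A' /= TK bT.
have mA := F_meas FA.
have -> : A `&` [set x | a x :: digits (size w) (T x) = j :: w] =
    T @^-1` (A' `&` [set x | digits (size w) x = w]).
  rewrite preimage_setI -TA' -setIA; congr (_ `&` _).
  by apply/seteqP; split => x /= [-> ->].
rewrite T_inv; last first.
  by apply: measurableI; [exact: F_meas|exact: measurable_digits].
rewrite IH//.
have mw := measurable_weight w.
have mwnu : measurable_fun setT (fun x => (weight w (nu x))%:E).
  by apply/measurable_EFinP; exact: measurableT_comp mw mnu.
have QT : (\int[Q]_(x in A') (weight w (nu x))%:E)%E =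
    (\int[Q]_(x in T @^-1` A') (weight w (nu (T x)))%:E)%E.
  transitivity (\int[pushforward Q T]_(x in A') (weight w (nu x))%:E)%E.
    by apply: eq_measure_integral => B mB _; rewrite /= /pushforward T_inv.
  rewrite ge0_integral_pushforward//.
  - exact: F_meas.
  - exact: measurable_funTS.
  - by move=> x _; rewrite lee_fin weight_ge0.
rewrite QT -TA'.
under eq_integral.
  move=> x; rewrite inE => -[_ /= axj]; rewrite nuT axj.
  over.
rewrite (@integral_conditional_density _ _ X M R Q nu (fun x => g j (nu x)) A
  [set x | a x = j] _ _ _ _ _ _ (fun m => weight w (Phi j m)))//.
- exact: measurableT_comp (mg j) mnu.
- by move=> B mB; apply: g_cond; apply: F_setI => //; exact: F_nu.
- exact: measurableT_comp mw (mPhi j).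
- by move=> m; exact: weight_ge0.
Qed.

Lemma measurable_gain : measurable_fun setT gain.
Proof.
apply: (measurable_fun_fincase (h := fun j x => g j (nu x)) ma) => j.
exact: measurableT_comp (mg j) mnu.
Qed.

Lemma measurable_gain_lt r : measurable [set x | gain x < r].
Proof.
have := measurable_preT measurable_gain (measurable_itv `]-oo, r[).
by congr measurable; apply/seteqP; split => x /=; rewrite in_itv.
Qed.

Lemma weight_digitsS n x :
  weight (digits n.+1 x) (nu x) =
  weight (digits n x) (nu x) * gain (iter n T x).
Proof.
have wS k y : weight (digits k.+1 y) (nu y) =
    gain y * weight (digits k (T y)) (nu (T y)) by rewrite /= -nuT.
elim: n x => [|n IH] x; first by rewrite /= mulr1 mul1r.
by rewrite wS IH iterSr wS mulrA.
Qed.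

Lemma weight_digits_nonincreasing n m x : (n <= m)%N ->
  weight (digits m x) (nu x) <= weight (digits n x) (nu x).
Proof.
move=> /subnKC <-; elim: (m - n)%N => [|k IH]; first by rewrite addn0.
by rewrite addnS weight_digitsS (le_trans _ IH)// ler_piMr ?weight_ge0 ?g_le1.
Qed.

Let visits_tail e n : set X := \bigcup_(k in [set k | (n <= k)%N])
  iter k T @^-1` [set x | gain x < e].

Let visits_often e : set X := \bigcap_n visits_tail e n.

Let measurable_visits_tail e n : measurable (visits_tail e n).
Proof.
apply: bigcup_measurable => k _.
by apply: measurable_preT; [exact: measurable_iter|exact: measurable_gain_lt].
Qed.

Let measurable_visits_often e : measurable (visits_often e).
Proof.
by apply: bigcap_measurable => // n _; exact: measurable_visits_tail.
Qed.

Let iterT n x : T (iter n T x) = iter n T (T x).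
Proof. exact: (iterSr n T x). Qed.

Let visits_invariant e : T @^-1` visits_often e = visits_often e.
Proof.
apply/seteqP; split => x /= vx n _.
  have [k /= nk gk] := vx n I; exists k.+1; first exact: leqW.
  by rewrite /preimage /= iterT.
have [[|k] //= nk gk] := vx n.+1 I; exists k => //.
by move: gk; rewrite /preimage /= iterT.
Qed.

Let measure_iter n A : measurable A -> Q (iter n T @^-1` A) = Q A.
Proof.
move=> mA; elim: n => // n IH.
rewrite -[RHS]IH -(T_inv (measurable_preT (measurable_iter n) mA)).
by congr (Q _); apply/seteqP; split => x /=; rewrite /preimage/= iterT.
Qed.

(* Poincare recurrence gives positive probability, ergodicity makes it 1. *)
Let visits_full e : Q [set x | gain x < e] <> 0%E -> Q (visits_often e) = 1%E.
Proof.
move=> Qe.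
have [Q0|//] := T_erg (measurable_visits_often e) (visits_invariant e).
exfalso; apply: Qe; apply/eqP; rewrite -measure_le0 -Q0.
have cv : Q (visits_tail e n) @[n --> \oo] --> Q (visits_often e).
  apply: nonincreasing_cvg_mu => //.
  - by rewrite (le_lt_trans (probability_le1 _ _))// ltry.
  - exact: measurable_visits_often.
  - move=> n m nm; apply/subsetPset => x [k /= mk gk]; exists k => //=.
    exact: leq_trans nm mk.
rewrite -(cvg_lim _ cv)//.
apply: lime_ge; first by apply/cvg_ex; eexists; exact: cv.
apply: nearW => n.
apply: (@le_trans _ _ (Q (iter n T @^-1` [set x | gain x < e]))).
  by rewrite measure_iter//; exact: measurable_gain_lt.
apply: le_measure; rewrite ?inE//.
  by apply: measurable_preT; [exact: measurable_iter|exact: measurable_gain_lt].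
by move=> x gx; exists n => /=.
Qed.

Let weight_visits e x K : 0 <= e -> visits_often e x ->
  exists n, weight (digits n x) (nu x) <= e ^+ K.
Proof.
move=> e0 vx; elim: K => [|K [n IH]].
  by exists 0%N; rewrite expr0.
have [k /= nk gk] := vx n I; exists k.+1.
rewrite weight_digitsS exprSr; apply: ler_pM => //.
- exact: weight_ge0.
- exact: g_ge0.
- exact: le_trans (weight_digits_nonincreasing x nk) IH.
- exact: ltW.
Qed.

Hypothesis gain_lt1 : Q [set x | gain x < 1] <> 0%E.

Let gain_lt_e : exists2 e, 0 <= e < 1 & Q [set x | gain x < e] <> 0%E.
Proof.
apply: contrapT => noe; apply: gain_lt1.
have -> : [set x | gain x < 1] = \bigcup_n [set x | gain x < 1 - n.+1%:R^-1].
  apply/seteqP; split => [x /= gx|x [n _ /= gx]]; last first.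
    by rewrite (lt_le_trans gx)// gerBl invr_ge0.
  have /ltr_add_invr[k hk] : gain x < 1 by [].
  by exists k => //=; rewrite ltrBrDr.
apply: (measure_negligible (mu := Q)).
  by apply: bigcup_measurable => n _; exact: measurable_gain_lt.
apply: negligible_bigcup => n; apply/negligibleP.
  exact: measurable_gain_lt.
apply: contrapT => Qn; apply: noe.
exists (1 - n.+1%:R^-1) => //.
by rewrite subr_ge0 invf_le1 ?ler1n//= ltrBlDr ltrDl.
Qed.

Let measurable_heavy c n :
  measurable [set x | c <= weight (digits n x) (nu x)].
Proof.
have -> : [set x | c <= weight (digits n x) (nu x)] =
    \bigcup_(w in [set: n.-tuple D]) ([set x | digits n x = w] `&`
      [set x | c <= weight w (nu x)]).
  apply/seteqP; split => [x /= gx|x [w _ [/= ->]]//].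
  by exists (Tuple (introT eqP (size_digits n x))).
apply: fin_bigcup_measurable => // w _; apply: measurableI.
  exact: measurable_digits.
have := measurable_preT (measurableT_comp (measurable_weight w) mnu)
  (measurable_itv `[c, +oo[).
by congr measurable; apply/seteqP; split => x /=; rewrite in_itv/= andbT.
Qed.

(** By ergodicity almost every orbit visits infinitely often a set where the
    weight of the word that is read shrinks by a fixed factor. *)
Lemma cvg_heavy c : 0 < c ->
  Q [set x | c <= weight (digits n x) (nu x)] @[n --> \oo] --> 0%E.
Proof.
move=> c0; have [e /andP[e0 e1] Qe] := gain_lt_e.
have -> : 0%E = Q (\bigcap_n [set x | c <= weight (digits n x) (nu x)]).
  apply/esym/eqP; rewrite -measure_le0.
  have -> : 0%E = Q (~` visits_often e).
    by rewrite probability_setC// visits_full// subee.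
  apply: le_measure; rewrite ?inE.
  - by apply: bigcap_measurable => // n _; exact: measurable_heavy.
  - exact: measurableC.
  - move=> x hx vx.
    have [K eK] : exists K, e ^+ K < c.
      have := @cvg_expr R e; rewrite ger0_norm// => /(_ e1).
      move=> /cvgrPdist_lt /(_ c c0) [K _ /(_ K (leqnn K))].
      by rewrite /= sub0r normrN ger0_norm ?exprn_ge0// => ?; exists K.
    have [n wn] := weight_visits K e0 vx.
    by have := hx n I; rewrite /= leNgt (le_lt_trans wn eK).
apply: nonincreasing_cvg_mu => //.
- by rewrite (le_lt_trans (probability_le1 _ _))// ltry.
- by apply: bigcap_measurable => // n _; exact: measurable_heavy.
- move=> n m nm; apply/subsetPset => x /= cx.
  exact: le_trans cx (weight_digits_nonincreasing x nm).
Qed.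

(** The state at time [n] lies in [C] only if the next [n] digits form the one
    word that leads into [C]. Given the past, this has probability the weight
    of that word. Cutting at a level [c], the event that the weight is at least
    [c] becomes rare by [cvg_heavy], and a word of weight less than [c] is read
    with probability at most [c]. *)
Theorem unique_word_null (C : set M) : measurable C ->
  (forall n (w w' : n.-tuple D) m, C (act w m) -> C (act w' m) -> w = w') ->
  Q (nu @^-1` C) = 0%E.
Proof.
move=> mC Cuniq; apply/eqP; rewrite -measure_le0.
have mnuC := measurable_preT mnu mC.
have key (c : R) : 0 < c -> forall n, (Q (nu @^-1` C) <=
    Q [set x | (c <= weight (digits n x) (nu x))%R] + c%:E)%E.
  move=> c0 n; rewrite -(measure_iter n mnuC).
  pose A (w : n.-tuple D) : set X :=
    nu @^-1` [set m | C (act w m) /\ weight w m < c].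
  have FA w : F (A w).
    apply: F_nu; apply: measurableI.
      exact: measurable_preT (measurable_act w) mC.
    have := measurable_preT (measurable_weight w) (measurable_itv `]-oo, c[).
    by congr measurable; apply/seteqP; split => x /=; rewrite in_itv.
  have mA w : measurable (A w) by exact: F_meas.
  pose E := \bigcup_(w in [set: n.-tuple D])
    (A w `&` [set x | digits (size w) x = w]).
  have mAd (w : n.-tuple D) :
      measurable (A w `&` [set x | digits (size w) x = w]).
    by apply: measurableI => //; exact: measurable_digits.
  have mE : measurable E by apply: fin_bigcup_measurable.
  have trivA : trivIset setT A.
    by move=> w w' _ _ [x [[Aw _] [Aw' _]]]; exact: Cuniq Aw Aw'.
  have sub : iter n T @^-1` (nu @^-1` C) `<=`
      [set x | c <= weight (digits n x) (nu x)] `|` E.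
    move=> x; rewrite /preimage/= nu_iter => Cx.
    have [cx|cx] := leP c (weight (digits n x) (nu x)); first by left.
    right; exists (Tuple (introT eqP (size_digits n x))) => //.
    by split; [split|rewrite /= size_digits].
  apply: (@le_trans _ _ (Q ([set x | c <= weight (digits n x) (nu x)] `|` E))).
    apply: le_measure; rewrite ?inE//.
      exact: measurable_preT (measurable_iter n) mnuC.
    by apply: measurableU => //; exact: measurable_heavy.
  apply: (le_trans (measureU2 _ _ _)) => //.
  have finT : finite_set [set: n.-tuple D] by exact: finite_finset.
  rewrite leeD2l// /E measure_fin_bigcup//; last first.
    move=> w w' _ _ [x [[Aw _] [Aw' _]]].
    by apply: (trivA w w') => //; exists x.
  apply: (@le_trans _ _ (\sum_(w \in [set: n.-tuple D]) c%:E * Q (A w))%E).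
    apply: lee_fsum => // w _.
    apply: (@le_trans _ _ (\int[Q]_(x in A w) (weight w (nu x))%:E)%E).
      by rewrite -(measure_digits _ (FA w)).
    rewrite -integral_cst//; apply: ge0_le_integral => //.
    - by move=> x _; rewrite lee_fin weight_ge0.
    - apply/measurable_EFinP/measurable_funTS.
      exact: measurableT_comp (measurable_weight w) mnu.
    - by move=> x [_ /= wx]; rewrite lee_fin ltW.
  rewrite -ge0_mule_fsumr// -measure_fin_bigcup//.
  rewrite -[leRHS]mule1; apply: lee_wpmul2l; first by rewrite lee_fin ltW.
  by apply: probability_le1; exact: fin_bigcup_measurable.
apply/lee_addgt0Pr => c c0; rewrite add0e.
have cv := cvg_heavy c0.
have : Q [set x | (c <= weight (digits n x) (nu x))%R] + c%:E @[n --> \oo] -->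
    (0 + c%:E)%E.
  by apply: cvgeD => //; exact: cvg_cst.
rewrite add0e => cvc; rewrite -(cvg_lim _ cvc)//.
apply: lime_ge; first by apply/cvg_ex; eexists; exact: cvc.
by apply: nearW => n; exact: key.
Qed.

End digit_process.
(** * Topologies determined by countably many functions *)

Section coordinates.
Variables (R : realType) (T : ptopologicalType) (I : countType).
Variable e : I -> T -> R.

(** The family [e] detects convergence of filters; then the topology is the one
    induced by [e], and, the index set being countable, it has a countable base. *)
Definition coordinates : Prop := forall (x : T) (F : set_system T), Filter F ->
  (forall i, e i y @[y --> F] --> e i x) -> F --> x.

Definition rational_box (b : seq rat * nat) : set T :=
  [set y | forall i, (pickle i < b.2)%N ->
    `|e i y - ratr (nth 0 b.1 (pickle i))| < b.2.+1%:R^-1].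

Lemma measurable_rational_box d (S : measurableType d) (f : S -> T) b :
  (forall i, measurable_fun setT (e i \o f : S -> R)) ->
  measurable (f @^-1` rational_box b).
Proof.
move=> mef; rewrite -[_ @^-1` _]setCK; apply: measurableC.
have -> : ~` (f @^-1` rational_box b) = \bigcup_i [set s | (pickle i < b.2)%N /\
    b.2.+1%:R^-1 <= `|e i (f s) - ratr (nth 0 b.1 (pickle i))|].
  apply/seteqP; split => [s /= /existsNP[i /not_implyP[ib /negP]]|].
    by rewrite -leNgt => h; exists i.
  by move=> s [i _ [/= ib h]] /(_ i ib); rewrite ltNge h.
apply: countable_bigcupT_measurable; first exact: countableP.
move=> i; have [ib|ib] := boolP (pickle i < b.2)%N; last first.
  by rewrite (_ : [set _ | _] = set0)//; apply/seteqP; split => s // [].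
have mh : measurable_fun setT
    (fun s => `|e i (f s) - ratr (nth 0 b.1 (pickle i))| : R).
  apply: measurableT_comp => //; apply: measurable_funB => //; exact: mef.
have := measurable_preT mh (measurable_itv `[b.2.+1%:R^-1, +oo[).
by congr measurable; apply/seteqP; split => s /=;
  rewrite in_itv/= andbT => // -[].
Qed.

Lemma rational_box_ex x N : exists q, rational_box (q, N) x.
Proof.
have N0 : 0 < N.+1%:R^-1 :> R by rewrite invr_gt0.
have /choice[q hq] : forall n, exists q : rat, forall i, pickle i = n ->
    `|e i x - ratr q| < N.+1%:R^-1.
  move=> n; have [[i <-]|ni] := pselect (exists i : I, pickle i = n);
    last by exists 0 => i ?; case: ni; exists i.
  have /rat_in_itvoo[q] : e i x - N.+1%:R^-1 < e i x + N.+1%:R^-1.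
    by rewrite ltrBlDr -addrA ltrDl addr_gt0.
  rewrite in_itv/= => /andP[q1 q2]; exists q => i' /(pcan_inj pickleK) ->.
  by rewrite ltr_distlC q1.
by exists (mkseq q N) => i /= iN; rewrite nth_mkseq//; exact: hq.
Qed.

Lemma rational_box_close b x y i : rational_box b x -> rational_box b y ->
  (pickle i < b.2)%N -> `|e i x - e i y| < 2 / b.2.+1%:R.
Proof.
move=> bx byy ib; set q := ratr (nth 0 b.1 (pickle i)) : R.
rewrite (_ : e i x - e i y = (e i x - q) - (e i y - q)); last by ring.
rewrite (le_lt_trans (ler_normB _ _))//.
rewrite (lt_le_trans (ltrD (bx i ib) (byy i ib)))//.
by rewrite -mulr2n mulr_natl.
Qed.

Hypothesis e_coord : coordinates.

(** The finite-dimensional neighbourhoods of [x] generate a filter that converges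
    to [x], so each neighbourhood of [x] contains one of them. *)
Lemma nbhs_rational_box x (U : set T) : nbhs x U ->
  exists2 b, rational_box b x & rational_box b `<=` U.
Proof.
move=> xU.
pose B N := [set y | forall i, (pickle i < N)%N ->
  `|e i x - e i y| < 2 / N.+1%:R].
have Bsub N N' : (N <= N')%N -> B N' `<=` B N.
  move=> NN' y By i iN; apply: lt_le_trans (By i (leq_trans iN NN')) _.
  by rewrite ler_pM2l// lef_pV2 ?posrE// ler_nat ltnS.
pose F : set_system T := filter_from setT B.
have FF : Filter F.
  apply: filter_from_filter; first by exists 0%N.
  move=> i j _ _; exists (maxn i j) => // y By.
  by split; apply: Bsub By; rewrite ?leq_maxl ?leq_maxr.
have : F --> x.
  apply: e_coord => i; apply/cvgrPdist_lt => eps eps0.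
  have [k hk] := ltr_add_invr (divr_gt0 eps0 (ltr0n R 2) : 0 < eps / 2).
  exists (maxn k (pickle i).+1) => // y By /=.
  have := By i; rewrite leq_maxr => /(_ isT) h; apply: (lt_le_trans h).
  rewrite -ler_pdivlMl// mulrC; apply: le_trans (ltW hk).
  by rewrite add0r lef_pV2 ?posrE// ler_nat ltnS leq_maxl.
move=> /(_ _ xU)[N _ NU]; have [q qx] := rational_box_ex x N.
exists (q, N) => // y qy; apply: NU => i iN.
exact: rational_box_close qx qy iN.
Qed.

(** As the rational boxes form a countable base, checking measurability
    coordinate by coordinate is enough. *)
Lemma measurable_fun_borel d (S : measurableType d) (f : S -> borel T) :
  (forall i, measurable_fun setT (e i \o f : S -> R)) -> measurable_fun setT f.
Proof.
move=> mef; apply: (@measurability _ _ S (borel T) setT f (@open T) erefl).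
move=> _ [U oU <-]; rewrite setTI.
have -> : U = \bigcup_(b in [set b | rational_box b `<=` U]) rational_box b.
  apply/seteqP; split => [x Ux|x [b /= bU bx]]; last exact: bU.
  have [b bx bU] := nbhs_rational_box (open_nbhs_nbhs (conj oU Ux)).
  by exists b.
rewrite preimage_bigcup bigcup_mkcond.
apply: countable_bigcupT_measurable; first exact: countableP.
move=> b; case: ifP => // _; exact: measurable_rational_box.
Qed.

End coordinates.

Lemma continuous_borel_measurable (R : realType) (T : ptopologicalType)
  (f : T -> R) : continuous f ->
  measurable_fun [set: borel T] (f : borel T -> R).
Proof.
move=> cf; apply: (measurability _ (RGenOpens.measurableE R)) => //.
move=> _ [_ [a [b ->]] <-]; rewrite setTI.
by apply: sub_sigma_algebra; exact: open_comp.
Qed.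

(** * Compactly supported functions and weak convergence *)

Section compactly_supported.
Variable R : realType.
Implicit Types (phi : R -> R) (nu : radon R).

(** Compact support in the form of a bound on the support, which is easier to
    establish and to use; see [ccP]. *)
Definition cc phi : Prop := continuous phi /\
  exists L : nat, forall x, L%:R < `|x| -> phi x = 0.

Lemma ccP phi :
  cc phi <-> continuous phi /\ compact (closure [set x | phi x != 0]).
Proof.
split=> -[cphi]; last first.
  move=> /compact_bounded[M [_ hM]]; split => //.
  exists (Num.truncn (`|M| + 1)).+1 => x Lx; apply/eqP; apply: contraT => px.
  have := hM (`|M| + 1); rewrite ltr_pwDr ?ler_norm// => /(_ isT x).
  have cx : closure [set x | phi x != 0] x by exact: subset_closure.
  move=> /(_ cx) /= xM.
  by have := lt_trans (truncnS_gt (`|M| + 1)) Lx; rewrite ltNge xM.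
move=> [L hL]; split => //.
have cL := @segment_compact R (- L%:R) L%:R.
apply: (subclosed_compact _ cL); first exact: closed_closure.
have cI : closed (`[- L%:R, L%:R]%classic : set R) by exact: interval_closed.
rewrite ((closure_id _).1 cI).
apply: closure_subset => x /= px; rewrite in_itv/= -ler_norml leNgt.
by apply/negP => /hL px0; rewrite px0 eqxx in px.
Qed.

Lemma ccZ r phi : cc phi -> cc (fun x => r * phi x).
Proof.
move=> [cphi [L hL]]; split; last by exists L => x /hL ->; rewrite mulr0.
by move=> x; apply: cvgM; [exact: cvg_cst|exact: cphi].
Qed.

Lemma ccD phi1 phi2 : cc phi1 -> cc phi2 -> cc (fun x => phi1 x + phi2 x).
Proof.
move=> [c1 [L1 h1]] [c2 [L2 h2]]; split.
  by move=> x; apply: cvgD; [exact: c1|exact: c2].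
exists (maxn L1 L2) => x hx; rewrite h1 ?h2 ?addr0//; apply: le_lt_trans hx;
  by rewrite ler_nat ?leq_maxl ?leq_maxr.
Qed.

Lemma cc_sum (J : Type) (s : seq J) (F : J -> R -> R) :
  (forall j, cc (F j)) -> cc (fun x => \sum_(j <- s) F j x).
Proof.
move=> cF; elim: s => [|j s IH].
  split; first by under eq_fun do rewrite big_nil; move=> x; exact: cvg_cst.
  by exists 0%N => x _; rewrite big_nil.
by under eq_fun do rewrite big_cons; exact: ccD.
Qed.

Lemma cc_comp phi (f g : R -> R) : cc phi -> continuous f -> continuous g ->
  cancel f g -> cc (phi \o f).
Proof.
move=> [cphi [L hL]] cf cg fK; split.
  by move=> x; apply: continuous_comp; [exact: cf|exact: cphi].
have /compact_bounded[M [_ hM]] : compact (g @` `[- L%:R, L%:R]).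
  apply: continuous_compact; last exact: segment_compact.
  exact: continuous_subspaceT.
exists (Num.truncn (`|M| + 1)).+1 => x Lx; apply: hL; rewrite ltNge.
apply/negP; rewrite ler_norml => fx.
have := hM (`|M| + 1); rewrite ltr_pwDr ?ler_norm// => /(_ isT x).
have gx : (g @` `[- L%:R, L%:R]) x by exists (f x) => //; rewrite /= in_itv.
move=> /(_ gx) /= xM.
by have := lt_trans (truncnS_gt (`|M| + 1)) Lx; rewrite ltNge xM.
Qed.

Lemma cc_integrable nu phi : cc phi ->
  (radon_measure nu).-integrable setT (EFin \o phi).
Proof.
move=> [cphi [L hL]].
have cL : compact (`[- L%:R, L%:R] : set R) by exact: segment_compact.
have -> : EFin \o phi = (EFin \o phi) \_ `[- L%:R, L%:R].
  apply/funext => x; rewrite patchE; case: ifPn => // /negP xL /=.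
  rewrite hL// ltNge; apply/negP => xL'; apply: xL; rewrite inE /= in_itv/=.
  by rewrite -ler_norml.
have mL : measurable (`[- L%:R, L%:R]%classic : set (measurableTypeR R)).
  exact: measurable_itv.
apply/(integrable_mkcond _ mL); apply: measurable_bounded_integrable => //.
- exact: radon_compact.
- by apply: measurable_funTS; exact: continuous_measurable_fun.
- have : compact (phi @` `[- L%:R, L%:R]).
    by apply: continuous_compact => //; exact: continuous_subspaceT.
  move=> /compact_bounded[M [Mr hM]]; exists M; split => // z Mz x /= xL.
  by apply: hM Mz _ _; exists x.
Qed.

Lemma Rintegral_sum nu (J : Type) (s : seq J) (F : J -> R -> R) :
  (forall j, cc (F j)) ->
  \int[radon_measure nu]_x (\sum_(j <- s) F j x) =
  \sum_(j <- s) \int[radon_measure nu]_x F j x.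
Proof.
move=> cF; elim: s => [|j s IH].
  under eq_Rintegral do rewrite big_nil.
  by rewrite Rintegral_cst// mul0r big_nil.
under eq_Rintegral do rewrite big_cons.
rewrite RintegralD//; [|exact: cc_integrable|exact/cc_integrable/cc_sum].
by rewrite IH big_cons.
Qed.

(** The nearest-point projection of the line onto the unit interval. *)
Definition clamp (t : R) : R := (`|t| - `|t - 1| + 1) / 2.

Lemma clamp_le0 t : t <= 0 -> clamp t = 0.
Proof. by move=> t0; rewrite /clamp !ler0_norm ?subr_le0//; lra. Qed.

Lemma clamp_ge1 t : 1 <= t -> clamp t = 1.
Proof. by move=> t1; rewrite /clamp !ger0_norm ?subr_ge0//; lra. Qed.

Lemma clamp_itv t : 0 <= clamp t <= 1.
Proof.
rewrite /clamp.
by case: (ger0P t) => t0; case: (ger0P (t - 1)) => t1; apply/andP; split; lra.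
Qed.

Lemma clamp_ge0 t : 0 <= clamp t.
Proof. by have /andP[] := clamp_itv t. Qed.

Lemma clamp_continuous : continuous clamp.
Proof.
move=> t; apply: cvgMl; apply: cvgD; last exact: cvg_cst.
apply: cvgB; first exact: norm_continuous.
apply: (@continuous_comp _ _ _ (fun t : R => t - 1) Num.norm).
  exact: translation_continuous.
exact: norm_continuous.
Qed.

Lemma tent_clamp t : clamp (1 - `|t|) = clamp (t + 1) - clamp t.
Proof.
have [t0|t0] := leP t 0.
  rewrite (clamp_le0 t0) subr0 (ler0_norm t0); congr clamp; ring.
have [t1|t1] := leP t 1.
  rewrite (@clamp_ge1 (t + 1)) ?lerDr ?ltW// (gtr0_norm t0) /clamp.
  by rewrite (ger0_norm (x := 1 - t)) ?(ler0_norm (x := 1 - t - 1))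
    ?(ger0_norm (x := t)) ?(ler0_norm (x := t - 1)); lra.
by rewrite (@clamp_ge1 (t + 1)) ?(@clamp_ge1 t) ?(gtr0_norm t0)
  ?clamp_le0 ?subrr//; lra.
Qed.

(** With parameters [(m, l, k)]: for [l = 1], the tent of half-width [1 / m.+1]
    centred at [k / m.+1]; for [m = k = 0] and large [l], a cutoff function. One
    countable family thus serves both to approximate test functions and to
    control masses. *)
Definition plateau (i : nat * nat * int) (x : R) : R :=
  clamp (i.1.2%:R - `|i.1.1.+1%:R * x - i.2%:~R|).

Lemma plateau_cc i : cc (plateau i).
Proof.
split.
  move=> x; apply: (@continuous_comp _ _ _
    (fun x : R => i.1.2%:R - `|i.1.1.+1%:R * x - i.2%:~R|) clamp);
    last exact: clamp_continuous.
  apply: cvgB; first exact: cvg_cst.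
  apply: (@continuous_comp _ _ _
    (fun x : R => i.1.1.+1%:R * x - i.2%:~R) Num.norm);
    last exact: norm_continuous.
  by apply: cvgB; [apply: cvgMr; exact: cvg_id|exact: cvg_cst].
exists (i.1.2 + `|i.2|)%N => x hx; rewrite /plateau clamp_le0// subr_le0.
have : `|i.1.1.+1%:R * x| - `|i.2%:~R| <= `|i.1.1.+1%:R * x - i.2%:~R|.
  exact: lerB_dist.
apply: le_trans; rewrite lerBrDr normrM ger0_norm//.
have -> : `|i.2%:~R : R| = `|i.2|%N%:R.
  by rewrite natr_absz intr_norm.
rewrite -natrD (le_trans (ltW hx))// ler_peMl//.
by rewrite ler1n.
Qed.

End compactly_supported.
Section plateau_approximation.
Variable R : realType.
Implicit Types (phi : R -> R) (nu : radon R).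

Lemma uniform_continuity_segment phi (A eps : R) : continuous phi -> 0 < eps ->
  exists2 delta, 0 < delta & forall x y, `|x| <= A -> `|x - y| < delta ->
    `|phi x - phi y| < eps.
Proof.
move=> cphi eps0.
have : near_covering (`[- A, A]%classic : set R).
  by apply/compact_near_coveringP; exact: segment_compact.
move=> /(_ R (0 : R)^'+ (fun delta x => forall y, `|x - y| < delta ->
  `|phi x - phi y| < eps)) /=.
have cov : forall x : R, (`[- A, A]%classic : set R) x ->
    \forall x' \near x & delta \near (0 : R)^'+,
    forall y : R, `|x' - y| < delta -> `|phi x' - phi y| < eps.
  move=> x _.
  have /cvgrPdist_lt /(_ (eps / 2)) := cphi x.
  rewrite divr_gt0// => /(_ isT) /nbhs_ballP[r /= r0 hr].
  exists ([set x' | `|x - x'| < r / 2], [set delta | delta < r / 2]).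
    split => /=; last by apply: nbhs_right_lt; rewrite divr_gt0.
    by apply/nbhs_ballP; exists (r / 2) => //=; rewrite divr_gt0.
  move=> [x' delta] /= [xx' dr] y x'y.
  have h1 : `|phi x - phi x'| < eps / 2.
    by apply: hr; rewrite /ball /= (lt_trans xx')// gtr_pMr//; lra.
  have h2 : `|phi x - phi y| < eps / 2.
    apply: hr; rewrite /ball /= (_ : x - y = (x - x') + (x' - y)); last by ring.
    by rewrite (le_lt_trans (ler_normD _ _))//; lra.
  rewrite (_ : phi x' - phi y = (phi x - phi y) - (phi x - phi x'));
    last by ring.
  by rewrite (le_lt_trans (ler_normB _ _))//; lra.
move=> /(_ _ cov) h.
have : \forall delta \near (0 : R)^'+, 0 < delta /\ (`[- A, A] `<=`
    (fun x => forall y, `|x - y| < delta -> `|phi x - phi y| < eps)).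
  near=> d; split; near: d; [exact: nbhs_right_gt|exact: h].
move=> /filter_ex[delta [d0 hd]]; exists delta => // x y xA xy.
by apply: hd => //=; rewrite in_itv/= -ler_norml.
Unshelve. all: by end_near. Qed.

(** Each tent is a difference of two shifted clamps, so the sum telescopes. *)
Lemma sum_tents (K : nat) (t : R) : `|t| <= K%:R ->
  \sum_(i < K.*2.+1) clamp (1 - `|t - (i%:Z - K%:Z)%:~R|) = 1.
Proof.
move=> tK.
pose h (i : nat) := - clamp (t + K.+1%:R - i%:R).
under eq_bigr => i _.
  rewrite tent_clamp (_ : clamp _ - clamp _ = h i.+1 - h i); last first.
    rewrite /h opprK [RHS]addrC rmorphB /= -!pmulrn.
    rewrite -![in i.+1%:R]natr1 -![in K.+1%:R]natr1.
    by congr (clamp _ - clamp _); ring.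
  over.
rewrite -(big_mkord xpredT (fun i => h i.+1 - h i)) telescope_sumr//.
move: tK; rewrite ler_norml => /andP[tK1 tK2].
rewrite /h opprK [LHS]addrC (@clamp_ge1 _ (t + _ - 0));
  last by rewrite -natr1; lra.
by rewrite clamp_le0 ?subr0// -!natr1 -addnn natrD; lra.
Qed.

(** Piecewise linear interpolation on a fine grid. The error is bounded not just
    uniformly but by a multiple of a cutoff function that does not depend on the
    grid: this keeps its integral small for all measures of bounded mass on a
    fixed interval. *)
Lemma plateau_approximation phi : cc phi ->
  exists L : nat, forall eps, 0 < eps -> exists m K : nat, forall x,
  `|phi x - \sum_(i < K) phi ((i%:Z - (K./2)%:Z)%:~R / m.+1%:R) *
     plateau (m, 1%N, i%:Z - (K./2)%:Z) x| <= eps * plateau (0%N, L.+2, 0) x.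
Proof.
move=> [cphi [L hL]]; exists L => eps eps0.
have [delta d0 hd] := uniform_continuity_segment L.+1%:R cphi eps0.
have [m hm] := ltr_add_invr d0; rewrite add0r in hm.
pose K := (m.+1 * L.+1)%N.
exists m, K.*2.+1 => x; rewrite (_ : K.*2.+1./2 = K) ?[LHS]/= ?uphalf_double//.
pose tent := fun i : nat => plateau (m, 1%N, i%:Z - K%:Z) x.
have m0 : 0 < m.+1%:R :> R by rewrite ltr0n.
have tent0 i : tent i != 0 -> `|x - (i%:Z - K%:Z)%:~R / m.+1%:R| < m.+1%:R^-1.
  apply: contraR; rewrite -leNgt => far; apply/eqP.
  rewrite /tent /plateau /= clamp_le0// subr_le0.
  rewrite (_ : m.+1%:R * x - (i%:Z - K%:Z)%:~R =
    m.+1%:R * (x - (i%:Z - K%:Z)%:~R / m.+1%:R)); last first.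
    by rewrite mulrBr mulrCA mulfV ?mulr1// gt_eqF.
  by rewrite normrM gtr0_norm// -(ler_pdivrMl _ _ m0) mulr1.
have [xL|xL] := leP `|x| L.+1%:R; last first.
  rewrite hL; last by rewrite (lt_trans _ xL)// ltr_nat.
  rewrite big1; first by rewrite subr0 normr0 mulr_ge0 ?clamp_ge0// ltW.
  move=> i _; rewrite -/(tent i).
  have [->|ti] := eqVneq (tent i) 0; first by rewrite mulr0.
  rewrite hL ?mul0r//; have := tent0 _ ti.
  set y := _ / _ => xy; have := ler_distD 0 x y.
  have m1 : m.+1%:R^-1 <= 1 :> R by rewrite invf_le1 ?ler1n.
  rewrite subr0 sub0r normrN => _; have := lerB_dist x y.
  have aux (l u v w z : R) :
    u < w -> w <= 1 -> l + 1 < v -> v - z <= u -> l < z by lra.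
  by rewrite -natr1 in xL; exact: aux xy m1 xL.
have -> : phi x = \sum_(i < K.*2.+1) phi x * tent i.
  rewrite -mulr_sumr /tent /plateau /= sum_tents ?mulr1//.
  by rewrite normrM gtr0_norm// /K natrM ler_pM2l.
rewrite -sumrB; apply: (le_trans (ler_norm_sum _ _ _)).
have -> : plateau (0%N, L.+2, 0) x = 1.
  rewrite /plateau /= clamp_ge1// mul1r subr0.
  by rewrite -natr1; lra.
apply: (@le_trans _ _ (\sum_(i < K.*2.+1) eps * tent i)).
  apply: ler_sum => i _; rewrite -/(tent i) -mulrBl normrM.
  have t0 : 0 <= tent i by exact: clamp_ge0.
  rewrite (ger0_norm t0).
  have [->|ti] := eqVneq (tent i) 0; first by rewrite !mulr0.
  rewrite ler_wpM2r// ltW// hd//; exact: lt_trans (tent0 _ ti) hm.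
rewrite -mulr_sumr /tent /plateau /= sum_tents//.
by rewrite normrM gtr0_norm// /K natrM ler_pM2l.
Qed.

(** Up to a small multiple of one fixed plateau, whose integral stays bounded along
    the filter, a test function is a linear combination of plateaus. *)
Lemma cvg_plateau_cc (U : Type) (F : set_system U) (m : U -> radon R) nu :
  Filter F ->
  (forall i, \int[radon_measure (m u)]_x plateau i x @[u --> F] -->
    \int[radon_measure nu]_x plateau i x) ->
  forall phi, cc phi -> \int[radon_measure (m u)]_x phi x @[u --> F] -->
    \int[radon_measure nu]_x phi x.
Proof.
move=> FF cF phi ccphi; apply/cvgrPdist_le => eta eta0.
have [L hL] := plateau_approximation ccphi.
pose chi := @plateau R (0%N, L.+2, 0).
pose C := \int[radon_measure nu]_x chi x + 1.
have C0 : 0 < C by rewrite ltr_wpDl// Rintegral_ge0// => x _; exact: clamp_ge0.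
have [k [K hK]] := hL (eta / (4 * C)) (divr_gt0 eta0 (mulr_gt0 (ltr0n _ 4) C0)).
pose c (i : 'I_K) := phi ((i%:Z - (K./2)%:Z)%:~R / k.+1%:R).
pose b (i : 'I_K) := (k, 1%N, i%:Z - (K./2)%:Z).
pose g x := \sum_(i < K) c i * plateau (b i) x.
have ccg : cc g by apply: cc_sum => i; apply/ccZ/plateau_cc.
have intg mu : \int[radon_measure mu]_x g x =
    \sum_(i < K) c i * \int[radon_measure mu]_x plateau (b i) x.
  rewrite Rintegral_sum; last by move=> i; apply/ccZ/plateau_cc.
  apply: eq_bigr => i _; rewrite RintegralZl//.
  exact/cc_integrable/plateau_cc.
have close mu :
    `|\int[radon_measure mu]_x phi x - \int[radon_measure mu]_x g x| <=
    eta / (4 * C) * \int[radon_measure mu]_x chi x.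
  have iphi := cc_integrable mu ccphi; have ig := cc_integrable mu ccg.
  rewrite -RintegralB// -RintegralZl//; last exact/cc_integrable/plateau_cc.
  have ccd : cc (fun x => phi x - g x).
    have -> : (fun x => phi x - g x) = (fun x => phi x + (-1) * g x).
      by apply/funext => x; rewrite mulN1r.
    by apply: ccD => //; exact: ccZ.
  apply: le_trans (le_normr_Rintegral _ _) _ => //; first exact: cc_integrable.
  apply: le_Rintegral => //.
  - by have := integrable_norm (cc_integrable mu ccd).
  - exact/cc_integrable/ccZ/plateau_cc.
have cg : \int[radon_measure (m u)]_x g x @[u --> F] -->
    \int[radon_measure nu]_x g x.
  rewrite intg; under eq_fun do rewrite intg.
  apply: cvg_big => [|i _]; first exact: add_continuous.
  by apply: cvgM; [exact: cvg_cst|exact: cF].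
have cchi := cF (0%N, L.+2, 0).
move/cvgrPdist_le : cg => /(_ (eta / 2)); rewrite divr_gt0// => /(_ isT) ng.
move/cvgrPdist_lt : cchi => /(_ 1 ltr01) nchi.
apply: filterS2 ng nchi => u hg hchi.
have chiC : \int[radon_measure (m u)]_x chi x <= C.
  have := ler_norm (\int[radon_measure (m u)]_x chi x -
    \int[radon_measure nu]_x chi x).
  by move: hchi; rewrite distrC -/chi /C; lra.
have h1 mu : \int[radon_measure mu]_x chi x <= C ->
    `|\int[radon_measure mu]_x phi x - \int[radon_measure mu]_x g x| <= eta / 4.
  move=> hC; apply: le_trans (close mu) _.
  rewrite (_ : eta / 4 = eta / (4 * C) * C); last by field; rewrite gt_eqF.
  by rewrite ler_wpM2l// divr_ge0// ltW// mulr_gt0.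
have h2 := h1 _ chiC.
have h3 : `|\int[radon_measure nu]_x phi x - \int[radon_measure nu]_x g x| <=
    eta / 4.
  by apply: h1; rewrite lerDl.
move: hg h2 h3.
have aux (p q s t : R) : `|s - t| <= eta / 2 -> `|q - t| <= eta / 4 ->
    `|p - s| <= eta / 4 -> `|p - q| <= eta.
  rewrite !ler_norml => /andP[? ?] /andP[? ?] /andP[? ?].
  by apply/andP; split; lra.
exact: aux.
Qed.

End plateau_approximation.
(** * Pushforwards and normalization *)

Section radon_calculus.
Variable R : realType.
Implicit Types (phi : R -> R) (nu : radon R).

Lemma radon_itv_fin nu a b (h1 h2 : bool) :
  nu [set` Interval (BSide h1 a) (BSide h2 b)] \is a fin_num.
Proof.
rewrite ge0_fin_numE//.
apply: le_lt_trans (radon_compact nu (@segment_compact R a b)).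
apply: le_measure; rewrite ?inE; [exact: measurable_itv|exact: measurable_itv|].
by apply: subset_itv; rewrite bnd_simp//; case: h1; case: h2.
Qed.

Lemma Rintegral_pushforward (f g : R -> R) (cf : continuous f)
    (cg : continuous g) (fK : cancel f g) (gK : cancel g f) nu phi : cc phi ->
  \int[radon_measure (radon_pushforward cf cg fK gK nu)]_x phi x =
  \int[radon_measure nu]_x phi (f x).
Proof.
move=> ccphi; rewrite /Rintegral; congr fine.
have mf : measurable_fun [set: measurableTypeR R] (f : _ -> measurableTypeR R).
  exact: continuous_measurable_fun.
have mphi : measurable_fun [set: measurableTypeR R] (EFin \o phi).
  by apply/measurable_EFinP; exact: continuous_measurable_fun ccphi.1.
have := @integral_pushforward _ _ _ _ R _ mf (radon_measure nu) setT _ mphi.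
rewrite preimage_setT; apply => //.
exact: (cc_integrable nu (cc_comp ccphi cf cg fK)).
Qed.

Lemma Rintegral_scale (c : {nonneg R}) nu phi : cc phi ->
  \int[radon_measure (radon_scale c nu)]_x phi x =
  c%:num * \int[radon_measure nu]_x phi x.
Proof.
move=> ccphi; have iphi := cc_integrable nu ccphi.
have mphi : measurable_fun [set: measurableTypeR R] (EFin \o phi).
  by apply/measurable_EFinP; exact: continuous_measurable_fun ccphi.1.
rewrite -RintegralZl// /Rintegral; congr fine.
under [RHS]eq_integral do rewrite EFinM.
rewrite integralZl// [in LHS]integralE [in RHS]integralE.
rewrite muleBr ?integrable_add_def//.
congr (_ - _)%E; apply: ge0_integral_mscale => //.
- exact: measurable_funepos.
- exact: measurable_funeneg.
Qed.

Lemma Rintegral_normalize nu phi : cc phi ->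
  \int[radon_measure (normalize nu)]_x phi x =
  (fine (nu (core (psi nu))))^-1 * \int[radon_measure nu]_x phi x.
Proof. exact: Rintegral_scale. Qed.

Lemma psi_eqP nu n : psi nu = n <->
  (charges_core nu n /\ forall k, (k < n)%N -> ~~ charges_core nu k) \/
  (n = 1%N /\ forall k, ~~ charges_core nu k).
Proof.
rewrite /psi; case: pselect => [ex|nex].
  case: ex_minnP => m cm mmin; split.
    move=> <-; left; split => // k km; apply/negP => /mmin.
    by rewrite leqNgt km.
  move=> [[cn nk]|[_ nk]]; last by have := nk m; rewrite cm.
  apply/eqP; rewrite eqn_leq mmin// leqNgt; apply/negP => /nk.
  by rewrite cm.
split => [<-|[[cn _]|[]//]]; last by case: nex; exists n.
by right; split => // k; apply/negP => ck; apply: nex; exists k.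
Qed.

Lemma normalize_scale (c : {nonneg R}) nu : 0 < c%:num ->
  normalize (radon_scale c nu) = normalize nu.
Proof.
move=> c0.
have cc (n : nat) : charges_core (radon_scale c nu) n = charges_core nu n.
  rewrite /charges_core /= /mscale; congr andb.
  by rewrite -[X in (X < _)%E](mule0 c%:num%:E) lte_pmul2l.
have psiE : psi (radon_scale c nu) = psi nu.
  by apply/psi_eqP; under eq_forall do rewrite cc; rewrite cc;
     under [in X in _ \/ X]eq_forall do rewrite cc; apply/psi_eqP.
apply: radon_ext => A mA; rewrite /= /mscale /= psiE /mscale.
rewrite muleA -EFinM; congr (_%:E * _)%E.
by rewrite fineM ?radon_itv_fin//= invfM mulrAC mulVf ?mul1r// gt_eqF.
Qed.

Lemma normalize_charge_gt0 nu : nu <> radon_zero R ->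
  0 < (fine (nu (core (psi nu))))^-1.
Proof.
move=> /charges_core_ex ex; rewrite invr_gt0 fine_gt0//.
have : charges_core nu (psi nu).
  by rewrite /psi; case: pselect => // ?; case: ex_minnP.
by move=> /andP[_ ->]; rewrite -ge0_fin_numE// radon_itv_fin.
Qed.

Lemma normalize_idem nu : normalize (normalize nu) = normalize nu.
Proof.
have [->|nu0] := pselect (nu = radon_zero R); first by rewrite !normalize_zero.
exact: (@normalize_scale (NngNum (core_weight_ge0 nu)) _
  (normalize_charge_gt0 nu0)).
Qed.

Lemma normalize_pushforward (f g : R -> R) (cf : continuous f)
    (cg : continuous g) (fK : cancel f g) (gK : cancel g f) nu :
  normalize (radon_pushforward cf cg fK gK (normalize nu)) =
  normalize (radon_pushforward cf cg fK gK nu).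
Proof.
have [->|nu0] := pselect (nu = radon_zero R); first by rewrite !normalize_zero.
rewrite -(@normalize_scale (NngNum (core_weight_ge0 nu))
  (radon_pushforward cf cg fK gK nu) (normalize_charge_gt0 nu0)).
by congr normalize; apply: radon_ext => A _.
Qed.

End radon_calculus.
(** * Measurable dependence on a measure *)

Section measurable_families.
Context (R : realType) d (S : measurableType d).
Implicit Types (m : S -> radon R) (phi : R -> R).

Definition measurable_family m : Prop := forall phi, cc phi ->
  measurable_fun setT (fun s => \int[radon_measure (m s)]_x phi x).

(* As n tends to infinity, these functions tend to the indicator of [a, b[; the
   slopes sit to the left of a and to the left of b. *)
Let trapezoid (a b : R) (n : nat) (x : R) : R :=
  clamp (n.+1%:R * (x - a) + 1) * clamp (n.+1%:R * (b - x)).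

Let trapezoid_out a b n x : ~~ (a - 1 <= x <= b) -> trapezoid a b n x = 0.
Proof.
have n1 : 1 <= n.+1%:R :> R by rewrite ler1n.
rewrite negb_and -!ltNge => /orP[xa|bx]; rewrite /trapezoid.
  rewrite (@clamp_le0 _ (_ + 1)) ?mul0r//.
  have : n.+1%:R * (x - a) <= 1 * (x - a) by rewrite ler_wnM2r//; lra.
  lra.
by rewrite (@clamp_le0 _ (_ * (b - x))) ?mulr0// pmulr_rle0 ?ltr0n//; lra.
Qed.

Let trapezoid_cc a b n : cc (trapezoid a b n).
Proof.
split.
  move=> x; apply: cvgM.
    apply: (@continuous_comp _ _ _ (fun x : R => n.+1%:R * (x - a) + 1)
      (@clamp R)); last exact: clamp_continuous.
    apply: cvgD; last exact: cvg_cst.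
    by apply: cvgMr; exact: translation_continuous.
  apply: (@continuous_comp _ _ _ (fun x : R => n.+1%:R * (b - x))
    (@clamp R)); last exact: clamp_continuous.
  by apply: cvgMr; apply: cvgB; [exact: cvg_cst|exact: cvg_id].
exists (Num.truncn (`|a| + 1 + `|b|)).+1 => x /(lt_trans (truncnS_gt _)) xab.
apply: trapezoid_out; apply/negP => /andP[ax xb].
have := ler_norm b; have := ler_norm (- a); rewrite normrN => ha hb.
have : `|x| <= `|a| + 1 + `|b|.
  rewrite ler_norml; have := normr_ge0 a; have := normr_ge0 b; lra.
by rewrite leNgt xab.
Qed.

Let trapezoid_cvg a b x :
  trapezoid a b n x @[n --> \oo] --> (\1_(`[a, b[%classic) x : R).
Proof.
rewrite indicE mem_setE in_itv/=.
suff [N hN] : exists N : nat, forall n, (N <= n)%N ->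
    trapezoid a b n x = (a <= x < b)%R%:R.
  by apply: cvg_near_cst; exists N => // n /= /hN.
have [xa|ax] := ltP x a; last have [xb|bx] := ltP x b.
- have [k] := ltr_add_invr (xa : x < a); rewrite -ltrBrDl => hk.
  exists k => n kn; rewrite /trapezoid clamp_le0 ?mul0r//.
  have h : k.+1%:R * (a - x) >= 1.
    by rewrite mulrC -ler_pdivrMr ?ltr0n// mul1r ltW.
  have : k.+1%:R * (a - x) <= n.+1%:R * (a - x).
    by rewrite ler_wpM2r ?ler_nat//; lra.
  by rewrite -(opprB a x) mulrN; lra.
- have [k] := ltr_add_invr xb; rewrite -ltrBrDl => hk.
  exists k => n kn; rewrite /trapezoid !clamp_ge1 ?mul1r//.
    have h : k.+1%:R * (b - x) >= 1.
      by rewrite mulrC -ler_pdivrMr ?ltr0n// mul1r ltW.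
    by apply: le_trans h _; rewrite ler_wpM2r ?ler_nat//; lra.
  by rewrite lerDr mulr_ge0//; lra.
- exists 0%N => n _; rewrite /trapezoid (@clamp_le0 _ (_ * (b - x))) ?mulr0//.
  by rewrite pmulr_rle0 ?ltr0n//; lra.
Qed.

Let trapezoid_integral_cvg (nu : radon R) a b :
  \int[radon_measure nu]_x trapezoid a b n x @[n --> \oo] -->
    fine (nu `[a, b[%classic).
Proof.
have mI : measurable (`[a, b[%classic : set (measurableTypeR R)).
  exact: measurable_itv.
have mJ : measurable (`[a - 1, b]%classic : set (measurableTypeR R)).
  exact: measurable_itv.
have mt n : measurable_fun [set: measurableTypeR R] (EFin \o trapezoid a b n).
  apply/measurable_EFinP.
  exact: continuous_measurable_fun (trapezoid_cc a b n).1.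
have [] := @dominated_convergence _ _ _ (radon_measure nu) setT measurableT
  (fun n x => (trapezoid a b n x)%:E) (fun x => (\1_(`[a, b[%classic) x)%:E)
  (fun x => (\1_(`[a - 1, b]%classic) x)%:E).
- exact: mt.
- exact/measurable_EFinP.
- apply: aeW => x _; apply: cvg_EFin; first exact: nearW.
  exact: trapezoid_cvg.
- apply/integrableP; split; first exact/measurable_EFinP.
  under eq_integral do rewrite gee0_abs ?lee_fin//.
  by rewrite integral_indic// setIT -ge0_fin_numE// radon_itv_fin.
- apply: aeW => x n _; rewrite lee_fin indicE mem_setE in_itv/=.
  have [_|/trapezoid_out ->] := boolP (a - 1 <= x <= b); last by rewrite normr0.
  have /andP[? ?] := clamp_itv (n.+1%:R * (x - a) + 1).
  have /andP[? ?] := clamp_itv (n.+1%:R * (b - x)).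
  by rewrite /trapezoid ger0_norm; [exact: mulr_ile1|exact: mulr_ge0].
move=> _ _; rewrite integral_indic// setIT => h.
by apply: fine_cvg; rewrite fineK ?radon_itv_fin//; exact: h.
Qed.

(** Half-open intervals are limits of compactly supported continuous functions,
    so their mass depends measurably on the measure. *)
Lemma measurable_itv_mass m a b : measurable_family m ->
  measurable_fun setT (fun s => fine (m s `[a, b[%classic)).
Proof.
move=> mm.
apply: (measurable_fun_cvg
  (h := fun n s => \int[radon_measure (m s)]_x trapezoid a b n x)).
- by move=> n; exact/mm/trapezoid_cc.
- by move=> s _; exact: trapezoid_integral_cvg.
Qed.

Let measurable_charges m n : measurable_family m ->
  measurable [set s | charges_core (m s) n].
Proof.
move=> mm; have [n0|n0] := boolP (0 < n)%N; last first.
  rewrite (_ : [set _ | _] = set0)//; apply/seteqP; split => // s /=.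
  by rewrite /charges_core (negbTE n0).
have := measurable_preT (measurable_itv_mass (- (n%:R - 1)) n%:R mm)
  (measurable_itv `]0, +oo[).
congr measurable; apply/seteqP; split => s /=; rewrite in_itv/= andbT.
  move=> h; rewrite /charges_core n0 /core.
  by rewrite -[nu in (_ < nu)%E]fineK ?radon_itv_fin.
by move=> /andP[_]; rewrite /core -[nu in (_ < nu)%E]fineK ?radon_itv_fin.
Qed.

Let measurable_psi m n : measurable_family m ->
  measurable [set s | psi (m s) = n].
Proof.
move=> mm.
have mc k : measurable [set s | ~~ charges_core (m s) k].
  rewrite (_ : [set _ | _] = ~` [set s | charges_core (m s) k]).
    exact/measurableC/measurable_charges.
  by apply/seteqP; split => s /= /negP.
have -> : [set s | psi (m s) = n] =
    ([set s | charges_core (m s) n] `&`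
     \bigcap_(k in [set k | (k < n)%N]) [set s | ~~ charges_core (m s) k]) `|`
    ([set s | n = 1%N] `&` \bigcap_k [set s | ~~ charges_core (m s) k]).
  apply/seteqP; split => s /=; rewrite psi_eqP.
    by move=> [[? h]|[? h]]; [left; split => // k; exact: h
                             |right; split => // k _; exact: h].
  by move=> [[? h]|[? h]]; [left; split => // k; exact: h
                           |right; split => // k; exact: (h k I)].
apply: measurableU; apply: measurableI.
- exact: measurable_charges.
- exact: bigcap_measurableType.
- have [->|n1] := pselect (n = 1%N).
    by rewrite (_ : [set _ | _] = setT)//; apply/seteqP; split.
  by rewrite (_ : [set _ | _] = set0)//; apply/seteqP; split.
- exact: bigcap_measurableType.
Qed.

Lemma measurable_family_normalize m : measurable_family m ->
  measurable_family (fun s => normalize (m s)).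
Proof.
move=> mm phi ccphi; under eq_fun do rewrite Rintegral_normalize//.
apply: measurable_funM; last exact: mm.
(* At 0, both the inverse and the power with exponent -1 are 0. *)
under eq_fun do rewrite -powR_inv1 ?fine_ge0//.
apply: (measurableT_comp (measurable_powR (-1))).
move=> _ B mB; rewrite setTI.
have -> : (fun s => fine (m s (core (psi (m s))))) @^-1` B =
    \bigcup_n ([set s | psi (m s) = n] `&`
      (fun s => fine (m s (core n))) @^-1` B).
  by apply/seteqP; split => [s Bs|s [n _ [/= <-]]//]; exists (psi (m s)).
apply: bigcup_measurable => n _.
apply: measurableI; first exact: measurable_psi.
exact: measurable_preT (measurable_itv_mass _ _ mm) mB.
Qed.

Lemma measurable_family_pushforward (f g : R -> R) (cf : continuous f)
    (cg : continuous g) (fK : cancel f g) (gK : cancel g f) m :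
  measurable_family m ->
  measurable_family (fun s => radon_pushforward cf cg fK gK (m s)).
Proof.
move=> mm phi ccphi; under eq_fun do rewrite Rintegral_pushforward//.
exact: mm (cc_comp ccphi cf cg fK).
Qed.

End measurable_families.
(** * The Borel structure of the state spaces *)

Section normalized_borel.
Variable R : realType.

Lemma normalized_integral_continuous (phi : R -> R) : cc phi ->
  continuous (fun nu : normalized R =>
    \int[radon_measure (set_val nu)]_x phi x).
Proof.
move=> /ccP[cphi Kphi] nu.
exact: ((@normalized_cvgP R (nbhs nu) nu _).1 cvg_id phi cphi Kphi).
Qed.

Lemma normalized_coordinates : coordinates
  (fun i (nu : normalized R) => \int[radon_measure (set_val nu)]_x plateau i x).
Proof.
move=> nu F FF cF; apply/normalized_cvgP => phi cphi Kphi.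
by apply: cvg_plateau_cc => //; apply/ccP.
Qed.

Lemma measurable_family_set_val :
  measurable_family (fun nu : borel (normalized R) => set_val nu).
Proof.
move=> phi ccphi.
exact: continuous_borel_measurable (normalized_integral_continuous ccphi).
Qed.

Lemma measurable_fun_normalized d (S : measurableType d)
    (f : S -> borel (normalized R)) :
  measurable_fun setT f <-> measurable_family (fun s => set_val (f s)).
Proof.
split=> [mf phi ccphi|mf].
  exact: (measurableT_comp (measurable_family_set_val ccphi) mf).
apply: measurable_fun_borel normalized_coordinates _ _ _ _ => i.
exact: (mf _ (plateau_cc R i)).
Qed.

Lemma measurable_fun_normalize_in d (S : measurableType d) (m : S -> radon R) :
  measurable_family m ->
  measurable_fun setT (fun s => normalize_in (m s) : borel (normalized R)).
Proof.
move=> mm; apply/measurable_fun_normalized.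
exact: measurable_family_normalize.
Qed.

Lemma measurable_translate_star (x : R) :
  measurable_fun setT
    (translate_star x : borel (normalized R) -> borel (normalized R)).
Proof.
apply: measurable_fun_normalize_in; apply: measurable_family_pushforward.
exact: measurable_family_set_val.
Qed.

End normalized_borel.

Section cp_borel.
Variables (R : realType) (p : nat) (p_ge2 : (2 <= p)%N).
Local Notation D := (digit p_ge2).
Local Notation X := (borel (cp_space R p_ge2)).
Local Notation M := (borel (normalized R)).

Definition cp_coordinate (i : nat * nat * int + int)
    (x : cp_space R p_ge2) : R :=
  match i with
  | inl b => \int[radon_measure (set_val x.1)]_t plateau b t
  | inr n => (x.2 n : 'I_p)%:R
  end.

Let dist_natr_ge1 (u v : nat) : u != v -> 1 <= `|u%:R - v%:R : R|.
Proof.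
wlog uv : u v / (u < v)%N.
  move=> h; case: ltngtP => // uv _; [|rewrite distrC];
    by apply: h; rewrite ?neq_ltn ?uv.
move=> _; rewrite distrC -(natrB _ (ltnW uv)) normr_nat.
by rewrite ler1n subn_gt0.
Qed.

Lemma cp_coordinates : coordinates cp_coordinate.
Proof.
move=> x F FF cF.
have F1 : (@fst (normalized R) (digit_seq p_ge2)) @ F --> x.1.
  by apply: normalized_coordinates => i; exact: (cF (inl i)).
have F2 : (@snd (normalized R) (digit_seq p_ge2)) @ F --> x.2.
  apply/cvg_sup => n.
  apply/(@initial_cvgP {ptws int -> D} D (fun g : {ptws int -> D} => g n)).
  move=> A xA; have Ax : A (x.2 n) by exact: nbhs_singleton.
  have /cvgrPdist_lt/(_ 1 ltr01) := cF (inr n).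
  apply: filterS => y /=; rewrite distrC => yx.
  suff -> : y.2 n = x.2 n by [].
  apply: val_inj; apply/eqP; move: yx; apply: contraTT => neq.
  by rewrite -leNgt /=; exact: dist_natr_ge1.
move=> A [[A1 A2] [/= xA1 xA2] A12].
have FA := @filterI _ F FF _ _ (F1 _ xA1) (F2 _ xA2).
by apply: (@filterS _ F FF _ _ _ FA) => -[y1 y2] h; exact: A12.
Qed.

Lemma measurable_nu_hat : measurable_fun setT (@nu_hat R p p_ge2).
Proof.
apply/measurable_fun_normalized => phi ccphi.
apply: (@continuous_borel_measurable R (cp_space R p_ge2)
  (fun x => \int[radon_measure (set_val x.1)]_t phi t)) => x.
apply: (@continuous_comp _ _ _ (fun x : cp_space R p_ge2 => x.1)
  (fun nu : normalized R => \int[radon_measure (set_val nu)]_t phi t)).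
  exact: cvg_fst.
exact: normalized_integral_continuous.
Qed.

Lemma measurable_i_hat n (B : set D) :
  measurable ((fun x : X => i_hat n x) @^-1` B).
Proof.
apply: sub_sigma_algebra.
apply: (@open_comp (cp_space R p_ge2) D (fun x => x.2 n));
  last exact: discrete_open.
move=> x _.
apply: (@continuous_comp _ _ _ (fun x : cp_space R p_ge2 => x.2)
  (fun g : {ptws int -> D} => g n)).
  exact: cvg_snd.
have /cvg_sup h : nbhs x.2 --> (x.2 : {ptws int -> D}) by exact: cvg_id.
exact: (iffLR (@initial_cvgP {ptws int -> D} D
  (fun g : {ptws int -> D} => g n) (nbhs x.2) x.2 _) (h n)).
Qed.

End cp_borel.
(** * The zooming map and its left inverse *)

Section cp_process.
Variables (R : realType) (p : nat) (p_ge2 : (2 <= p)%N).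
Local Notation X := (borel (cp_space R p_ge2)).
Local Notation M := (borel (normalized R)).

Definition next_digit (x : X) : 'I_p := i_hat 1 x.
Definition last_digit (x : X) : 'I_p := i_hat 0 x.

Definition zoom_in (j : 'I_p) (nu : M) : M :=
  normalize_in (rho_pushforward j (set_val nu)).

Definition rho_pullback (j : 'I_p) (nu : radon R) : radon R :=
  radon_pushforward (@rho_inv_continuous R p j) (@rho_continuous R p j)
    (@rho_invK R p j) (@rhoK R p j) nu.

Definition zoom_out (j : 'I_p) (nu : M) : M :=
  normalize_in (rho_pullback j (set_val nu)).

Definition M_inverse (x : X) : X :=
  (zoom_out (last_digit x) x.1, fun n => x.2 (n - 1)).

Lemma normalize_set_val (nu : normalized R) :
  normalize (set_val nu) = set_val nu.
Proof.
have [mu _ e] := set_mem (valP nu).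
by rewrite -[set_val nu]/(\val nu) -e normalize_idem.
Qed.

(** A blow-up forgets nothing: it transforms the measure on the whole line by a
    homeomorphism, and normalization changes a nonzero measure by a positive
    factor, which a further normalization undoes. *)
Lemma zoom_inK j : cancel (zoom_in j) (zoom_out j).
Proof.
move=> nu; apply: val_inj => /=.
rewrite normalize_pushforward -[RHS]normalize_set_val; congr normalize.
apply: radon_ext => A _ /=; rewrite /pushforward /=; congr (set_val nu _).
by apply/seteqP; split => x /=; rewrite /preimage /= rhoK.
Qed.

Lemma M_mapK : cancel (@M_map R p p_ge2) M_inverse.
Proof.
move=> [nu i]; rewrite /M_inverse /M_map /=; congr (_, _).
  exact: zoom_inK.
by apply/funext => n; rewrite subrK.
Qed.

Lemma measurable_zoom_in j : measurable_fun setT (zoom_in j).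
Proof.
apply: measurable_fun_normalize_in; apply: measurable_family_pushforward.
exact: measurable_family_set_val.
Qed.

Lemma measurable_zoom_out j : measurable_fun setT (zoom_out j).
Proof.
apply: measurable_fun_normalize_in; apply: measurable_family_pushforward.
exact: measurable_family_set_val.
Qed.

Lemma measurable_M_map : measurable_fun setT (@M_map R p p_ge2).
Proof.
apply: (measurable_fun_borel (@cp_coordinates R p p_ge2)) => -[i|n].
  pose h (j : 'I_p) (x : X) : R :=
    \int[radon_measure (set_val (zoom_in j x.1))]_t plateau i t.
  have mh j : measurable_fun setT (h j).
    have mz := measurableT_comp (measurable_zoom_in j)
      (@measurable_nu_hat R p p_ge2).
    exact: ((measurable_fun_normalized _).1 mz _ (plateau_cc R i)).
  exact: (measurable_fun_fincase
    (fun j => @measurable_i_hat R p p_ge2 1 [set j]) mh).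
move=> _ B mB; rewrite setTI.
exact: (@measurable_i_hat R p p_ge2 (n + 1)
  [set j : digit p_ge2 | B (j : 'I_p)%:R]).
Qed.

Let past_generators : set (set X) :=
  [set (@nu_hat R p p_ge2) @^-1` A | A in measurable] `|`
  [set (i_hat n) @^-1` B |
    n in [set n | n <= 0] & B in [set: set (digit p_ge2)]].

Lemma past_setI (A B : set X) : past A -> past B -> past (A `&` B).
Proof. exact: (@measurableI _ (g_sigma_algebraType past_generators)). Qed.

Lemma past_nu_hat (B : set M) : measurable B ->
  past (@nu_hat R p p_ge2 @^-1` B).
Proof. by move=> mB; apply: sub_sigma_algebra; left; exists B. Qed.

Lemma past_i_hat (n : int) (B : set (digit p_ge2)) : n <= 0 ->
  past ((i_hat n : X -> _) @^-1` B).
Proof.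
by move=> n0; apply: sub_sigma_algebra; right; exists n => //; exists B.
Qed.

Lemma past_measurable : @past R p p_ge2 `<=` measurable.
Proof.
apply: smallest_sub; first exact: sigma_algebra_measurable.
move=> _ [[A mA <-]|[n _ [B _ <-]]].
  exact: measurable_preT (@measurable_nu_hat R p p_ge2) mA.
exact: measurable_i_hat.
Qed.

(** Going back in time, the past only gets smaller: the state one step ago and the
    earlier digits are functions of the present state and of the digits up to the
    present one. *)
Lemma past_M_inverse (A : set X) : past A -> past (M_inverse @^-1` A).
Proof.
have mS : measurable_fun setT (M_inverse :
    g_sigma_algebraType past_generators -> g_sigma_algebraType past_generators).
  apply: (@measurability _ _ (g_sigma_algebraType past_generators)
    (g_sigma_algebraType past_generators) setT M_inverse past_generators erefl).
  move=> _ [_ [[A' mA <-]|[n n0 [B _ <-]]] <-]; rewrite setTI; last first.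
    by apply: (@past_i_hat (n - 1) B); rewrite subr_le0 (le_trans n0).
  have -> : M_inverse @^-1` (@nu_hat R p p_ge2 @^-1` A') =
      \bigcup_(j in [set: 'I_p]) ([set x | last_digit x = j] `&`
        @nu_hat R p p_ge2 @^-1` (zoom_out j @^-1` A')).
    by apply/seteqP; split => [x Bx|x [j _ [/= <-]]//]; exists (last_digit x).
  apply: (@fin_bigcup_measurable _ (g_sigma_algebraType past_generators)) => //.
  move=> j _.
  apply: past_setI; first exact: (@past_i_hat 0 [set j]).
  by apply: past_nu_hat; exact: measurable_preT (measurable_zoom_out j) mA.
move=> pA; have := mS measurableT A pA; rewrite setTI; exact.
Qed.

(** The cap at 1 changes nothing almost surely, by [cond_prob_le1]; it makes the
    bounds on weights hold at every point. *)
Definition cell_gain (j : 'I_p) (nu : M) : R :=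
  Num.min 1 (fine (set_val nu (@cell R p p_ge2 j))).

Lemma measurable_cell_gain j : measurable_fun setT (cell_gain j).
Proof.
apply: measurable_minr; first exact: measurable_cst.
exact: measurable_itv_mass (@measurable_family_set_val R).
Qed.

Lemma cell_gain_ge0 j nu : 0 <= cell_gain j nu.
Proof. by rewrite le_min ler01 fine_ge0. Qed.

Lemma cell_gain_le1 j nu : cell_gain j nu <= 1.
Proof. by rewrite ge_min lexx. Qed.

End cp_process.
(** * Blow-ups of the same level are translates of each other *)

Section words.
Variables (R : realType) (p : nat).
Local Notation M := (borel (normalized R)).

(** The integer with base [p] digits [w], most significant digit first. *)
Fixpoint offset (w : seq 'I_p) : nat :=
  if w is j :: w' then (j * p ^ size w' + offset w')%N else 0%N.

Lemma offset_lt (w : seq 'I_p) : (offset w < p ^ size w)%N.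
Proof.
elim: w => [|j w IH] //=; rewrite expnS.
apply: (@leq_trans (j.+1 * p ^ size w)%N).
  by rewrite mulSn addnC ltn_add2r.
by rewrite leq_mul2r ltn_ord orbT.
Qed.

Lemma offset_inj (w w' : seq 'I_p) :
  size w = size w' -> offset w = offset w' -> w = w'.
Proof.
elim: w w' => [|j w IH] [|j' w'] //= [sw] eqo.
have := offset_lt w; have := offset_lt w'; rewrite -sw => lt' lt.
have p0 : (0 < p ^ size w)%N by exact: leq_trans lt.
rewrite -sw in eqo.
have jj' : j = j' :> nat.
  have := congr1 (divn ^~ (p ^ size w)%N) eqo.
  by rewrite /= !divnMDl// !divn_small// !addn0.
rewrite (val_inj jj') (IH w')//.
by apply/eqP; rewrite -(eqn_add2l (j * p ^ size w)) eqo jj'.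
Qed.

(** The affine maps of the single steps compose, and the intermediate
    normalizations are absorbed by the last one. *)
Lemma act_affine (w : seq 'I_p) (m : M) : exists (f g : R -> R)
    (cf : continuous f) (cg : continuous g) (fK : cancel f g) (gK : cancel g f),
  (forall x, f x = p%:R ^+ size w * x - (offset w)%:R :> R) /\
  set_val (act (@zoom_in R p) w m) =
    normalize (radon_pushforward cf cg fK gK (set_val m)).
Proof.
elim: w m => [|j w IH] m.
  have cid : continuous (@id R) by move=> x; exact: cvg_id.
  exists id, id, cid, cid, (fun=> erefl), (fun=> erefl); split.
    by move=> x; rewrite expr0 mul1r subr0.
  rewrite /= -[LHS]normalize_set_val; congr normalize.
  exact: radon_ext.
have [f [g [cf [cg [fK [gK [fE actE]]]]]]] := IH (zoom_in j m).
have cf' : continuous (f \o @rho R p j).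
  by move=> x; apply: continuous_comp; [exact: rho_continuous|exact: cf].
have cg' : continuous (@rho_inv R p j \o g).
  by move=> x; apply: continuous_comp; [exact: cg|exact: rho_inv_continuous].
have fK' : cancel (f \o @rho R p j) (@rho_inv R p j \o g).
  by move=> x /=; rewrite fK rhoK.
have gK' : cancel (@rho_inv R p j \o g) (f \o @rho R p j).
  by move=> x /=; rewrite rho_invK gK.
exists _, _, cf', cg', fK', gK'; split.
  move=> x; rewrite /= fE /rho /= natrD natrM natrX exprS; ring.
rewrite /= actE /= normalize_pushforward; congr normalize.
exact: radon_ext.
Qed.

(** By [act_affine], both sides come from affine maps with the same slope and
    integer offsets. *)
Lemma translate_star_act (w w' : seq 'I_p) (m : M) : size w = size w' ->
  translate_star ((offset w')%:Z - (offset w)%:Z)%:~R (act (@zoom_in R p) w m) =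
  act (@zoom_in R p) w' m.
Proof.
move=> sw; apply: val_inj => /=.
have [f [g [cf [cg [fK [gK [fE actE]]]]]]] := act_affine w m.
have [f' [g' [cf' [cg' [fK' [gK' [fE' actE']]]]]]] := act_affine w' m.
transitivity (set_val (act (@zoom_in R p) w' m)); last by [].
rewrite actE actE' normalize_pushforward; congr normalize.
apply: radon_ext => A _ /=; rewrite /pushforward /=.
congr (set_val m _); apply/seteqP.
split => x; rewrite /preimage /= fE fE' sw rmorphB /= -!pmulrn;
  by rewrite opprB addrA subrK.
Qed.

End words.
(** * Conditional probabilities of the next digit *)

Section conditional_gain.
Variables (R : realType) (p : nat) (p_ge2 : (2 <= p)%N).
Local Notation X := (borel (cp_space R p_ge2)).
Variable Q : probability X R.

(** A set in [G] on which [f] is at least [1 + n.+1^-1] is null: by the defining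
    property, the integral of [f] over it is at most its mass. *)
Lemma cond_prob_le1 (G : set (set X)) (E : set X) (f : X -> R) :
  G `<=` measurable -> measurable E -> is_cond_prob Q G E f ->
  \forall x \ae Q, f x <= 1.
Proof.
move=> Gm mE [Gf intf fE].
have mf : measurable_fun setT f.
  by move=> _ B mB; rewrite setTI; apply: Gm; exact: Gf.
pose A n := f @^-1` `[1 + n.+1%:R^-1, +oo[.
have GA n : G (A n) by apply: Gf; exact: measurable_itv.
have QA n : Q (A n) = 0%E.
  have mA := Gm _ (GA n).
  have le : ((1 + n.+1%:R^-1)%:E * Q (A n) <= Q (A n))%E.
    apply: (@le_trans _ _ (\int[Q]_(x in A n) (f x)%:E)%E).
      rewrite -integral_cst//; apply: ge0_le_integral => //.
      - by move=> x _; rewrite lee_fin addr_ge0.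
      - by apply/measurable_EFinP; exact: measurable_funTS.
      - by move=> x; rewrite /A /= in_itv/= andbT lee_fin.
    by rewrite fE//; apply: le_measure; rewrite ?inE//; exact: measurableI.
  have fQ : Q (A n) \is a fin_num by exact: fin_num_measure.
  move: le; rewrite -(fineK fQ) -EFinM lee_fin => le.
  have q0 : 0 <= fine (Q (A n)) by rewrite fine_ge0.
  have n0 : 0 < n.+1%:R^-1 :> R by [].
  congr EFin; apply/eqP; rewrite eq_le q0 andbT -(pmulr_rle0 _ n0).
  by move: le; rewrite mulrDl mul1r gerDl.
have : Q.-negligible (\bigcup_n A n).
  apply: negligible_bigcup => n.
  by apply/negligibleP; [exact: (Gm _ (GA n))|exact: QA].
apply: negligibleS => x /= /negP; rewrite -ltNge => /ltr_add_invr[k hk].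
by exists k => //; rewrite /A /= in_itv/= andbT ltW.
Qed.

Lemma cond_cell_gain (j : 'I_p) (A : set X) : adapted Q -> past A ->
  Q (A `&` [set x | next_digit x = j]) =
  (\int[Q]_(x in A) (cell_gain p_ge2 j (x.1 : normalized R))%:E)%E.
Proof.
move=> adQ pA; have [f cf fE] := adQ j.
have [Gf intf fint] := cf; rewrite -fint//.
have mA := past_measurable pA.
have f1 := cond_prob_le1 (@past_measurable R p p_ge2)
  (@measurable_i_hat R p p_ge2 1 [set j]) cf.
apply: ae_eq_integral => //.
- apply: measurable_funTS; apply/measurable_EFinP => _ B mB.
  by rewrite setTI; apply: past_measurable; exact: Gf.
- apply: measurable_funTS; apply/measurable_EFinP.
  exact: measurableT_comp (@measurable_cell_gain R p p_ge2 j)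
    (@measurable_nu_hat R p p_ge2).
- apply: filterS2 f1 fE => x f1 fE _; congr EFin.
  have fE' : f x = fine (set_val (x.1 : normalized R) (@cell R p p_ge2 j)).
    exact: (congr1 fine fE).
  by rewrite /cell_gain -fE' min_r.
Qed.

(** Otherwise the next digit would almost surely have conditional probability 1. *)
Lemma gain_lt1_nonnull : adapted Q -> ~ deterministic Q ->
  Q [set x | cell_gain p_ge2 (next_digit x) (x.1 : normalized R) < 1] <> 0%E.
Proof.
move=> adQ; apply: contra_not => Q0.
have /choice[f hf] : forall j : digit p_ge2, exists f,
    is_cond_prob Q (@past R p p_ge2) [set x | i_hat 1 x = j] f /\
    \forall x \ae Q, (f x)%:E = set_val (nu_hat x) (cell j).
  by move=> j; have [f h1 h2] := adQ j; exists f.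
exists f; first by move=> j; have [] := hf j.
have all1 : \forall x \ae Q, forall j : 'I_p, f j x <= 1 /\
    (f j x)%:E = set_val (nu_hat x) (@cell R p p_ge2 j).
  apply: filter_forall => j; have [cf fE] := hf j.
  have f1 := cond_prob_le1 (@past_measurable R p p_ge2)
    (@measurable_i_hat R p p_ge2 1 [set j]) cf.
  by apply: filterS2 f1 fE => x.
have gain1 : \forall x \ae Q,
    1 <= cell_gain p_ge2 (next_digit x) (x.1 : normalized R).
  exists [set x | cell_gain p_ge2 (next_digit x) (x.1 : normalized R) < 1].
  split => //; last by move=> x /= /negP; rewrite -ltNge.
  exact: (measurable_gain_lt (@measurable_nu_hat R p p_ge2)
    (fun j => @measurable_i_hat R p p_ge2 1 [set j])
    (@measurable_cell_gain R p p_ge2)).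
apply: filterS2 all1 gain1 => x /(_ (next_digit x))[f1 fE].
rewrite le_min lexx /= => g1; apply/eqP; rewrite eq_le f1 /=.
by rewrite (le_trans g1)// -[leRHS]/(fine (f (next_digit x) x)%:E) fE.
Qed.

End conditional_gain.
(** * Isolated measures *)

Section recurrence.
Variables (R : realType) (p : nat) (p_ge2 : (2 <= p)%N).
Local Notation X := (borel (cp_space R p_ge2)).
Local Notation M := (borel (normalized R)).
Local Notation e := (fun i (nu : normalized R) =>
  \int[radon_measure (set_val nu)]_x plateau i x).

Definition isolated (B : set (normalized R)) : set M :=
  [set nu | B nu /\ forall k : int, k != 0 -> ~ B (translate_star k%:~R nu)].

Lemma measurable_isolated b : measurable (isolated (rational_box e b)).
Proof.
have mb : measurable (rational_box e b : set M).
  have := @measurable_rational_box R (normalized R) _ e _ M id b.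
  rewrite preimage_id; apply => i.
  exact: (@measurable_family_set_val R _ (plateau_cc R i)).
have -> : isolated (rational_box e b) = rational_box e b `&`
    ~` \bigcup_(k : int) (if k == 0 then set0 else
      translate_star k%:~R @^-1` (rational_box e b : set M)).
  apply/seteqP; split => [nu [bnu h]|nu [bnu h]]; split => //.
    by move=> [k _]; case: eqVneq => // k0; exact: h.
  by move=> k k0 bk; apply: h; exists k => //; rewrite (negbTE k0).
apply: measurableI => //; apply: measurableC.
apply: countable_bigcupT_measurable; first exact: countableP.
move=> k; case: ifP => // _.
exact: measurable_preT (@measurable_translate_star R k%:~R) mb.
Qed.

Variable Q : probability X R.

(** If two words of the same length led from one state to isolated measures of the
    box, each of these would be a translate of the other by a nonzero integer. *)
Lemma isolated_nu_hat_null b : extended_ECPD Q -> ~ deterministic Q ->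
  Q (@nu_hat R p p_ge2 @^-1` isolated (rational_box e b)) = 0%E.
Proof.
move=> [adQ invQ ergQ] ndQ.
apply: (@unique_word_null _ _ X M R 'I_p Q
  (@M_map R p p_ge2) (@M_inverse R p p_ge2) (@nu_hat R p p_ge2)
  (@next_digit R p p_ge2) (@last_digit R p p_ge2)
  (@zoom_in R p) (@cell_gain R p p_ge2) (@past R p p_ge2)) => //.
- exact: measurable_M_map.
- exact: measurable_nu_hat.
- by move=> j; exact: (@measurable_i_hat R p p_ge2 1 [set j]).
- exact: measurable_zoom_in.
- exact: measurable_cell_gain.
- exact: cell_gain_ge0.
- exact: cell_gain_le1.
- exact: M_mapK.
- exact: past_measurable.
- exact: past_setI.
- exact: past_nu_hat.
- by move=> j; exact: (@past_i_hat R p p_ge2 0 [set j]).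
- exact: past_M_inverse.
- by move=> j A pA; exact: cond_cell_gain.
- exact: gain_lt1_nonnull.
- exact: measurable_isolated.
- move=> n w w' m [_ hw] [bw' _]; apply: val_inj.
  have sw : size w = size w' by rewrite !size_tuple.
  apply: contrapT => ww'.
  have : (offset w')%:Z - (offset w)%:Z != 0 :> int.
    rewrite subr_eq0; apply/eqP => -[/esym /offset_inj].
    by apply: contra_not ww'; exact.
  by move=> /hw; rewrite translate_star_act.
Qed.

End recurrence.

Theorem corollary1p12 (R : realType) (p : nat) (p_ge2 : (2 <= p)%N)
    (Q : probability (borel (cp_space R p_ge2)) R) :
  extended_ECPD Q -> ~ deterministic Q ->
  \forall nu \ae pushforward Q (@nu_hat R p p_ge2),
    exists k : nat -> int, (forall n, k n != 0) /\
      (fun n => translate_star (k n)%:~R nu) @ \oo --> nu.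
Proof.
move=> ecpQ ndQ.
pose e := fun i (nu : normalized R) =>
  \int[radon_measure (set_val nu)]_x plateau i x.
have mI b := @measurable_isolated R b.
pose Bad : set (borel (normalized R)) := \bigcup_b isolated (rational_box e b).
have mBad : measurable Bad.
  by apply: countable_bigcupT_measurable => //; exact: countableP.
exists Bad; split => //.
  rewrite /pushforward /Bad preimage_bigcup.
  apply: (measure_negligible (mu := Q)).
    apply: countable_bigcupT_measurable; first exact: countableP.
    by move=> b; exact: measurable_preT (@measurable_nu_hat R p p_ge2) (mI b).
  have : Q.-negligible (\bigcup_n (if @unpickle (seq rat * nat)%type n is Some b
      then @nu_hat R p p_ge2 @^-1` isolated (rational_box e b) else set0)).
    apply: negligible_bigcup => n.
    case: unpickle => [b|]; last exact: negligible_set0.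
    apply/negligibleP; last exact: isolated_nu_hat_null.
    exact: measurable_preT (@measurable_nu_hat R p p_ge2) (mI b).
  by apply: negligibleS => x [b _ bx]; exists (pickle b) => //; rewrite pickleK.
move=> nu /=; apply: contra_notP => nuBad.
(* Rational boxes of growing size around nu shrink to nu. *)
have near_return n : exists k : int, k != 0 /\ forall i, (pickle i < n)%N ->
    `|e i nu - e i (translate_star k%:~R nu)| < 2 / n.+1%:R.
  have [q qnu] := rational_box_ex e nu n.
  have [k [k0 qk]] : exists k : int, k != 0 /\
      rational_box e (q, n) (translate_star k%:~R nu).
    apply: contrapT => nok; apply: nuBad; exists (q, n) => //; split => //.
    by move=> k k0 kb; apply: nok; exists k.
  by exists k; split => // i; exact: rational_box_close qnu qk.
have [k hk] := choice near_return.
exists k; split => [n|]; first by have [] := hk n.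
apply: (@normalized_coordinates R) => i; apply/cvgrPdist_lt => eps eps0.
have [N hN] := ltr_add_invr (divr_gt0 eps0 (ltr0n R 2) : 0 < eps / 2).
exists (maxn N (pickle i).+1) => // n /= Nn.
have [_ /(_ i)] := hk n; rewrite (leq_trans _ Nn) ?leq_maxr// => /(_ isT) h.
apply: (lt_le_trans h); rewrite -ler_pdivlMl// mulrC; apply: le_trans (ltW hN).
rewrite add0r lef_pV2 ?posrE// ler_nat ltnS (leq_trans _ Nn)//.
exact: leq_maxl.
Qed.
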